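(* Let $\lambda>0$. If $E\subset\mathbb{H}$ is a connected $\lambda$-vertical curve, then there are an interval $I\subset\mathbb{R}$ and a map $\gamma\colon I\to\mathbb{H}$ such that $\gamma$ sends $I$ homeomorphically to $E$ and $$\gamma(t)\in\gamma(s)\,\mathrm{VCone}^+_\lambda\qquad\text{for all } s,t\in I \text{ such that } s<t.$$ If $E$ is compact, then we can take $\gamma$ to be a bi-H\''older map from $[0,1]$ to $E$. That is, there are exponents $0<\alpha<\beta<1$ depending on $\lambda$ and there is a $C>0$ depending on $E$ such that for all $s,t\in[0,1]$ with $s\neq t$, $$C^{-1}|s-t|^\beta<d(\gamma(s),\gamma(t))<C|s-t|^\alpha.$$
   Context: $\mathbb{H}$ is the first Heisenberg group, identified with $\mathbb{R}^3$ with the group law $(x,y,z)(x',y',z')=\left(x+x',y+y',z+z'+\tfrac12(xy'-x'y)\right)$. The Kor\'anyi norm is $|(x,y,z)|_{\mathrm{Kor}}=\sqrt[4]{(x^2+y^2)^2+16z^2}$ and the distance is $d(a,b)=|b^{-1}a|_{\mathrm{Kor}}$. For $\lambda>0$, $\mathrm{VCone}_\lambda=\{(x,y,z)\in\mathbb{H}: |z|\ge\lambda(x^2+y^2)\}$ and $\mathrm{VCone}^+_\lambda=\mathrm{VCone}_\lambda\cap\{z\ge0\}$. A set $E\subset\mathbb{H}$ is a $\lambda$-vertical curve if $E\subset p\,\mathrm{VCone}_\lambda$ for all $p\in E$.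
   Formalization: In the compact case E is assumed to have at least two points: for a one-point E the strict lower bound fails because d(γ(s),γ(t)) = 0, and for empty E there is no map from [0,1] to E. *)

(* Defs.v *)
From HB Require Import structures.
From mathcomp Require Import all_boot all_order all_algebra.
From mathcomp Require Import ring.
From mathcomp Require Import all_classical all_reals all_analysis.

Set Implicit Arguments.
Unset Strict Implicit.
Unset Printing Implicit Defensive.

Import Order.TTheory GRing.Theory Num.Theory.
Import numFieldNormedType.Exports.

Local Open Scope classical_set_scope.
Local Open Scope ring_scope.

(* R^3 with its product (Euclidean) topology; the group law is the Heisenberg
   one, and the componentwise addition of R * R * R is deliberately not
   inherited. *)
Definition heis (R : realType) : Type := (R * R * R)%type.

HB.instance Definition _ (R : realType) :=
  Topological.copy (heis R) (R * R * R)%type.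

Section HeisenbergGroup.
Variable R : realType.
Implicit Types p q : heis R.

Definition heis_x p : R := p.1.1.
Definition heis_y p : R := p.1.2.
Definition heis_z p : R := p.2.

Definition heis_one : heis R := (0, 0, 0).

Definition heis_inv p : heis R := (- heis_x p, - heis_y p, - heis_z p).

Definition heis_mul p q : heis R :=
  (heis_x p + heis_x q,
   heis_y p + heis_y q,
   heis_z p + heis_z q
     + 2^-1 * (heis_x p * heis_y q - heis_x q * heis_y p)).

Lemma heis_mulA : associative heis_mul.
Proof.
move=> [[x y] z] [[x' y'] z'] [[x'' y''] z''].
by rewrite /heis_mul /heis_x /heis_y /heis_z /=; congr (_, _, _); ring.
Qed.

Lemma heis_mul1 : left_id heis_one heis_mul.
Proof.
move=> [[x y] z]; rewrite /heis_mul /heis_x /heis_y /heis_z /=.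
by congr (_, _, _); ring.
Qed.

Lemma heis_mulr1 : right_id heis_one heis_mul.
Proof.
move=> [[x y] z]; rewrite /heis_mul /heis_x /heis_y /heis_z /=.
by congr (_, _, _); ring.
Qed.

Lemma heis_mulV : left_inverse heis_one heis_inv heis_mul.
Proof.
move=> [[x y] z]; rewrite /heis_mul /heis_inv /heis_x /heis_y /heis_z /=.
by congr (_, _, _); ring.
Qed.

Lemma heis_mulrV : right_inverse heis_one heis_inv heis_mul.
Proof.
move=> [[x y] z]; rewrite /heis_mul /heis_inv /heis_x /heis_y /heis_z /=.
by congr (_, _, _); ring.
Qed.

HB.instance Definition _ := isGroup.Build (heis R)
  heis_mulA heis_mul1 heis_mulr1 heis_mulV heis_mulrV.

Definition kor_norm p : R :=
  ((heis_x p ^+ 2 + heis_y p ^+ 2) ^+ 2 + 16 * heis_z p ^+ 2) `^ 4^-1.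

Definition kor_dist p q : R := kor_norm (q^-1 * p)%g.

Definition ltranslate p (V : set (heis R)) : set (heis R) :=
  [set (p * v)%g | v in V].

Definition VCone (lambda : R) : set (heis R) :=
  [set p | lambda * (heis_x p ^+ 2 + heis_y p ^+ 2) <= `|heis_z p|].

Definition VConeP (lambda : R) : set (heis R) :=
  VCone lambda `&` [set p | 0 <= heis_z p].

Definition vertical_curve (lambda : R) (E : set (heis R)) : Prop :=
  forall p, E p -> E `<=` ltranslate p (VCone lambda).

Definition increasing_param (lambda : R) (I : set R) (gamma : R -> heis R) :
    Prop :=
  forall s t, I s -> I t -> s < t ->
    ltranslate (gamma s) (VConeP lambda) (gamma t).

End HeisenbergGroup.

(* Both A and B carry their subspace topologies; the values of f outside A and
   of the inverse g outside B are irrelevant. *)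
Definition homeo_onto (T U : topologicalType) (A : set T) (B : set U)
    (f : T -> U) : Prop :=
  [/\ set_bij A B f, {within A, continuous f} &
      exists2 g : U -> T, {in A, cancel f g} & {within B, continuous g}].

(* Main.v *)
Require Import Defs.
From HB Require Import structures.
From mathcomp Require Import all_boot all_order all_algebra.
From mathcomp Require Import ring lra.
From mathcomp Require Import all_classical all_reals all_analysis.

Import Order.TTheory GRing.Theory Num.Theory.
Import numFieldNormedType.Exports.

Local Open Scope classical_set_scope.
Local Open Scope ring_scope.

(** For p, q in the Heisenberg group let rise p q be the z-coordinate of
    p^-1 q and run p q the squared length of its horizontal part, so that E is
    a lam-vertical curve when lam * run p q <= |rise p q| on E, and so that
    the Koranyi distance satisfies d^4 = run^2 + 16 rise^2.  All estimates are
    made on dist2 = d^2.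

    Order.  Two points of E with rise 0 coincide, so every p in E splits
    E minus p into the open sets above p (rise p x > 0) and below p.  A cycle
    p < q < r < p would disconnect E, hence the relation 0 < rise p q is a
    total order on E (curve_lt_trans).  The arcs of this order have bounded
    turning: for p <= q <= q' <= r the distance from q to q' is at most a
    constant, depending only on lam, times the distance from p to r
    (curve_nested).  The area term in the group law is absorbed by the cone
    condition.

    Parametrization.  A continuous strictly increasing real function tau on E
    has an interval as image, because E is connected, and its inverse is
    continuous, because no point of E is isolated on a side where E has points
    (curve_parametrization).  Such a tau always exists: sum, over a dense
    sequence q in E and with summable weights, the truncated distance that the
    curve reaches from q before arriving at the given point; bounded turning
    makes each term Lipschitz (curve_global_parameter).

    Bi-Hoelder parameter.  If E is compact it has a first point a and a last
    point b.  By connectedness every arc has an equidistant intermediate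
    point, so arcs can be bisected again and again; tau sends the resulting
    grid points to the dyadic numbers.  Each exponent comes from one estimate
    on bisections.
    - On the cone the triangle inequality improves: if m is equidistant from p
      and q then dist2 p q <= theta * dist2 p m with theta < 4
      (dist2_le_mid).  After k bisections an arc still has dist2 at least
      theta^-k * dist2 a b, so the exponent of d is log2 theta / 2 < 1.
    - There is J, depending only on lam, such that J bisections halve dist2
      (curve_halving).  If they did not, the J discarded sibling arcs would
      all be long, and would yield J well separated points in a bounded
      region, more than the doubling property allows (heis_doubling).  The
      exponent of d is 1 / (2 J). *)

(** * Squared distance and the cone condition *)

Section Alg.
Context {R : realType}.
Implicit Types p q r m : heis R.

(** Antisymmetric in p and q: its sign will order a vertical curve. *)
Definition rise p q : R := heis_z (p^-1 * q)%g.
Definition dx p q : R := heis_x q - heis_x p.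
Definition dy p q : R := heis_y q - heis_y p.
Definition run p q : R := dx p q ^+ 2 + dy p q ^+ 2.
Definition hyp (a b : R) : R := Num.sqrt (a ^+ 2 + b ^+ 2).
(** The squared Koranyi distance, see [sqr_kor_dist]. *)
Definition dist2 p q : R := hyp (run p q) (4 * rise p q).

Lemma riseE p q : rise p q = heis_z q - heis_z p
   - 2^-1 * (heis_x p * heis_y q - heis_x q * heis_y p).
Proof. by rewrite /rise /heis_z/=/heis_mul/heis_inv/heis_x/heis_y/heis_z/=;
  ring. Qed.

Lemma mulV_xE p q : heis_x (p^-1 * q)%g = dx p q.
Proof. by rewrite /dx addrC. Qed.

Lemma mulV_yE p q : heis_y (p^-1 * q)%g = dy p q.
Proof. by rewrite /dy addrC. Qed.

Lemma rise_split p q r :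
  rise p r = rise p q + rise q r + 2^-1 * (dx p q * dy q r - dx q r * dy p q).
Proof. by rewrite !riseE /dx /dy; field. Qed.

Lemma rise_pair p q r : rise q r = rise p r - rise p q
   - 2^-1 * (dx p q * dy p r - dx p r * dy p q).
Proof. by rewrite !riseE /dx /dy; field. Qed.

Lemma riseC p q : rise q p = - rise p q.
Proof. by rewrite !riseE; ring. Qed.

Lemma rise_self p : rise p p = 0.
Proof. by rewrite riseE; ring. Qed.

Lemma runC p q : run q p = run p q.
Proof. by rewrite /run /dx /dy; ring. Qed.

Lemma run_ge0 p q : 0 <= run p q.
Proof. by rewrite addr_ge0 ?sqr_ge0. Qed.

Lemma run_split p q r :
  run p r = run p q + run q r + 2 * (dx p q * dx q r + dy p q * dy q r).
Proof. by rewrite /run /dx /dy; ring. Qed.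

Lemma hyp_ge0 a b : 0 <= hyp a b.
Proof. exact: sqrtr_ge0. Qed.

Lemma sqr_hyp a b : hyp a b ^+ 2 = a ^+ 2 + b ^+ 2.
Proof. by rewrite sqr_sqrtr // addr_ge0 ?sqr_ge0. Qed.

Lemma hyp_le a b c : 0 <= c -> a ^+ 2 + b ^+ 2 <= c ^+ 2 -> hyp a b <= c.
Proof.
by move=> c0 h; rewrite -(@ler_pXn2r _ 2) ?nnegrE ?hyp_ge0// sqr_hyp.
Qed.

Lemma hyp_ge a b c : 0 <= c -> c ^+ 2 <= a ^+ 2 + b ^+ 2 -> c <= hyp a b.
Proof.
by move=> c0 h; rewrite -(@ler_pXn2r _ 2) ?nnegrE ?hyp_ge0// sqr_hyp.
Qed.

Lemma hypD a b c d : hyp (a + c) (b + d) <= hyp a b + hyp c d.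
Proof.
apply: hyp_le; first by rewrite addr_ge0 ?hyp_ge0.
suff : a * c + b * d <= hyp a b * hyp c d.
  have := sqr_hyp a b; have := sqr_hyp c d; nra.
apply: le_trans (ler_norm _) _.
rewrite -(@ler_pXn2r _ 2) ?nnegrE ?mulr_ge0 ?hyp_ge0//.
rewrite real_normK ?num_real// exprMn !sqr_hyp.
have := sqr_ge0 (a * d - b * c); lra.
Qed.

Lemma dist2_ge0 p q : 0 <= dist2 p q.
Proof. exact: hyp_ge0. Qed.

Lemma dist2C p q : dist2 q p = dist2 p q.
Proof. by rewrite /dist2 runC riseC /hyp mulrN sqrrN. Qed.

Lemma dist2_self p : dist2 p p = 0.
Proof. by rewrite /dist2 /hyp rise_self /run /dx /dy !subrr !expr0n/=
  !(addr0,mulr0) expr0n/= addr0 sqrtr0. Qed.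

Lemma run_le_dist2 p q : run p q <= dist2 p q.
Proof. by apply: hyp_ge; rewrite ?run_ge0// lerDl sqr_ge0. Qed.

Lemma rise_le_dist2 p q : 4 * `|rise p q| <= dist2 p q.
Proof.
apply: hyp_ge; first by rewrite mulr_ge0.
by rewrite !exprMn real_normK ?num_real// lerDr sqr_ge0.
Qed.

Lemma dist2_le p q : dist2 p q <= run p q + 4 * `|rise p q|.
Proof.
apply: hyp_le; first by rewrite addr_ge0 ?run_ge0// mulr_ge0.
have h : `|rise p q| ^+ 2 = rise p q ^+ 2 by rewrite real_normK ?num_real.
have := run_ge0 p q; have := normr_ge0 (rise p q); nra.
Qed.

Lemma dist2_gt0 p q : rise p q != 0 -> 0 < dist2 p q.
Proof.
rewrite -normr_gt0 => h; apply: lt_le_trans (rise_le_dist2 p q).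
by rewrite mulr_gt0.
Qed.

Lemma kor_dist_ge0 p q : 0 <= kor_dist p q.
Proof. exact: powR_ge0. Qed.

Lemma sqr_kor_dist p q : kor_dist p q ^+ 2 = dist2 p q.
Proof.
rewrite -[RHS]ger0_norm ?dist2_ge0// -sqrtr_sqr sqr_hyp.
rewrite /kor_dist /kor_norm -/(rise q p) mulV_xE mulV_yE -/(run q p) runC riseC.
rewrite -powR_mulrn ?powR_ge0// -powRrM -powR12_sqrt; last first.
  by rewrite addr_ge0 ?sqr_ge0.
congr (_ `^ _); last by field.
by ring.
Qed.

Lemma kor_distC p q : kor_dist q p = kor_dist p q.
Proof.
by apply/eqP; rewrite -(@eqrXn2 _ 2) ?kor_dist_ge0// !sqr_kor_dist dist2C.
Qed.

Lemma kor_dist_gt0 p q : rise p q != 0 -> 0 < kor_dist p q.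
Proof.
move=> /dist2_gt0 h; rewrite lt_neqAle kor_dist_ge0 andbT.
by apply/eqP => e; move: h; rewrite -sqr_kor_dist -e expr0n ltxx.
Qed.

(** Let v, w be the horizontal parts of p^-1 q and q^-1 r.  The complex number
    |v|^2 + 4 i z has modulus dist2, and the group law adds 2 conj(v) w, of
    modulus 2 |v| |w|, to the sum of the two such numbers.  Keeping the product
    of the runs, instead of bounding it by the distances, is what yields a
    constant below 4 in [dist2_le_mid]. *)
Lemma dist2_tri p q r :
  dist2 p r <= dist2 p q + dist2 q r + 2 * Num.sqrt (run p q * run q r).
Proof.
have -> : dist2 p r = hyp
    (run p q + run q r + 2 * (dx p q * dx q r + dy p q * dy q r))
    (4 * rise p q + 4 * rise q r + 2 * (dx p q * dy q r - dx q r * dy p q)).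
  by rewrite /dist2 (run_split p q r) (rise_split p q r); congr hyp; field.
apply: le_trans (hypD _ _ _ _) _; apply: lerD; first exact: hypD.
apply: hyp_le; first by rewrite mulr_ge0// sqrtr_ge0.
rewrite !exprMn sqr_sqrtr ?mulr_ge0 ?run_ge0//.
by rewrite le_eqVlt; apply/orP; left; apply/eqP; rewrite /run; ring.
Qed.

Lemma sqrtM_le (a b c d : R) : 0 <= a -> 0 <= b -> a <= c ^+ 2 -> b <= d ^+ 2 ->
  0 <= c -> 0 <= d -> Num.sqrt (a * b) <= c * d.
Proof.
move=> a0 b0 ac bd c0 d0.
rewrite -(@ler_pXn2r _ 2) ?nnegrE ?mulr_ge0 ?sqrtr_ge0//.
by rewrite sqr_sqrtr ?mulr_ge0// exprMn ler_pM.
Qed.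

Lemma kor_dist_tri p q r : kor_dist p r <= kor_dist p q + kor_dist q r.
Proof.
rewrite -(@ler_pXn2r _ 2) ?nnegrE ?addr_ge0 ?kor_dist_ge0//.
rewrite sqr_kor_dist; apply: le_trans (dist2_tri p q r) _.
have : Num.sqrt (run p q * run q r) <= kor_dist p q * kor_dist q r.
  by apply: sqrtM_le;
    rewrite ?run_ge0 ?kor_dist_ge0 ?sqr_kor_dist ?run_le_dist2.
have := sqr_kor_dist p q; have := sqr_kor_dist q r; nra.
Qed.

Lemma dist2_tri2 p q r : dist2 p r <= 2 * (dist2 p q + dist2 q r).
Proof.
rewrite -!sqr_kor_dist.
have := kor_dist_tri p q r; have := kor_dist_ge0 p r.
have := kor_dist_ge0 p q; have := kor_dist_ge0 q r.
have := sqr_ge0 (kor_dist p q - kor_dist q r); nra.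
Qed.

Lemma heis_eq p q : run p q = 0 -> rise p q = 0 -> p = q.
Proof.
move: p q => [[x y] z] [[x' y'] z'].
rewrite riseE /run /dx /dy /heis_x/heis_y/heis_z/= => h1 h2.
have := sqr_ge0 (x' - x); have := sqr_ge0 (y' - y) => hy hx.
have /eqP : (x' - x) ^+ 2 = 0 by lra.
have /eqP : (y' - y) ^+ 2 = 0 by lra.
rewrite !sqrf_eq0 !subr_eq0 => /eqP ? /eqP ?; subst x' y'.
by congr (_, _, _); lra.
Qed.

End Alg.

Section Cone.
Context {R : realType}.
Variable lam : R.
Hypothesis lam0 : 0 < lam.
Implicit Types p q r m : heis R.

(** Bound for the rise of a subarc in terms of the rise of an arc. *)
Definition rise_turning : R := 2 + (4 * lam ^+ 2)^-1.

(** Membership of q in the upper cone with vertex p. *)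
Definition below p q := lam * run p q <= rise p q.

(** The area spanned by two horizontal displacements is at most
    lam |v|^2 + |w|^2 / (4 lam), and the cone condition bounds both squares by
    the rises. *)
Lemma shear_le p q r : lam * run p q <= `|rise p q| ->
   lam * run p r <= `|rise p r| ->
  `| dx p q * dy p r - dx p r * dy p q | <=
    `|rise p q| + (4 * lam ^+ 2)^-1 * `|rise p r|.
Proof.
move=> h1 h2.
have e : (4 * lam ^+ 2)^-1 = (4 * lam)^-1 * lam^-1.
  by field; rewrite gt_eqF.
have h3 : (4 * lam)^-1 * run p r <= (4 * lam ^+ 2)^-1 * `|rise p r|.
  rewrite e -!mulrA ler_pM2l ?invr_gt0 ?mulr_gt0//.
  by rewrite mulrC ler_pdivlMr // mulrC.
suff h : `| dx p q * dy p r - dx p r * dy p q | <=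
  lam * run p q + (4 * lam)^-1 * run p r.
  by move: h h1 h3; lra.
have h5 a b : a * b <= lam * a ^+ 2 + (4 * lam)^-1 * b ^+ 2.
  rewrite -subr_ge0.
  have -> : lam * a ^+ 2 + (4 * lam)^-1 * b ^+ 2 - a * b = lam * (a
    - (2 * lam)^-1 * b) ^+ 2.
    by field; rewrite gt_eqF.
  by rewrite mulr_ge0 ?sqr_ge0 // ltW.
rewrite /run ler_norml; apply/andP; split.
  have := h5 (- dx p q) (dy p r); have := h5 (dy p q) (dx p r);
    rewrite !sqrrN; lra.
have := h5 (dx p q) (dy p r); have := h5 (- dy p q) (dx p r); rewrite !sqrrN;
  lra.
Qed.

(** Since rise q r is nonnegative, rise p q exceeds rise p r by at most half the
    area of [shear_le], half of rise p q being absorbed on the left. *)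
Lemma rise_le_l p q r : below p q -> 0 <= rise q r -> below p r ->
  rise p q <= rise_turning * rise p r.
Proof.
move=> h1 h2 h3.
have h1' : 0 <= rise p q by apply: le_trans h1; rewrite mulr_ge0 ?run_ge0// ltW.
have h3' : 0 <= rise p r by apply: le_trans h3; rewrite mulr_ge0 ?run_ge0// ltW.
have := shear_le p q r; rewrite (ger0_norm h1') (ger0_norm h3') => /(_ h1 h3).
have := rise_pair p q r; rewrite /rise_turning.
set w := dx p q * _ - _; set k := (4 * lam ^+ 2)^-1.
have := ler_norm (- w); rewrite normrN; lra.
Qed.

Lemma rise_le_r p q r : below q r -> 0 <= rise p q -> below p r ->
  rise q r <= rise_turning * rise p r.
Proof.
move=> h1 h2 h3.
have h1' : 0 <= rise q r by apply: le_trans h1; rewrite mulr_ge0 ?run_ge0// ltW.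
have h3' : 0 <= rise p r by apply: le_trans h3; rewrite mulr_ge0 ?run_ge0// ltW.
have := shear_le r q p;
  rewrite [run r q]runC [run r p]runC (riseC q r) (riseC p r).
rewrite !normrN (ger0_norm h1') (ger0_norm h3') => /(_ h1 h3).
have := rise_pair r q p;
  rewrite /rise_turning (riseC p q) (riseC q r) (riseC p r).
set w := dx r q * _ - _; set k := (4 * lam ^+ 2)^-1.
have := ler_norm w; lra.
Qed.

(** In the cone, 4 |rise| <= dist2 <= cone_ratio * |rise|. *)
Definition cone_ratio : R := 4 + lam^-1.

Lemma dist2_le_rise p q : lam * run p q <= `|rise p q| ->
  dist2 p q <= cone_ratio * `|rise p q|.
Proof.
move=> h; apply: le_trans (dist2_le _ _) _; rewrite /cone_ratio.
have : run p q <= lam^-1 * `|rise p q| by rewrite mulrC ler_pdivlMr // mulrC.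
lra.
Qed.

(** The bounded turning constant for dist2 in [curve_nested]. *)
Definition turning : R := (cone_ratio * rise_turning ^+ 2).

Lemma rise_turning_ge1 : 1 <= rise_turning.
Proof.
have : 0 <= (4 * lam ^+ 2)^-1 by rewrite invr_ge0 mulr_ge0 ?sqr_ge0.
rewrite /rise_turning; lra.
Qed.

Lemma cone_ratio_ge4 : 4 <= cone_ratio.
Proof. by rewrite /cone_ratio lerDl invr_ge0 ltW. Qed.

Lemma turning_ge1 : 1 <= turning.
Proof. rewrite /turning; have := rise_turning_ge1; have := cone_ratio_ge4;
  nra. Qed.

(** The cone condition gives run <= dist2 / sqrt (1 + 16 lam^2); theta is what
    [dist2_tri] then yields for two equal distances. *)
Definition theta : R := 2 + 2 / Num.sqrt (1 + 16 * lam ^+ 2).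

Lemma run_le_cone p q : lam * run p q <= `|rise p q| ->
  run p q <= (Num.sqrt (1 + 16 * lam ^+ 2))^-1 * dist2 p q.
Proof.
move=> h.
have p0 : 0 < 1 + 16 * lam ^+ 2 by have := sqr_ge0 lam; lra.
rewrite mulrC ler_pdivlMr ?sqrtr_gt0//.
apply: hyp_ge; first by rewrite mulr_ge0 ?run_ge0 ?sqrtr_ge0.
rewrite exprMn sqr_sqrtr ?(ltW p0)//.
have : (lam * run p q) ^+ 2 <= `|rise p q| ^+ 2.
  by rewrite ler_pXn2r ?nnegrE ?mulr_ge0 ?run_ge0// ltW.
rewrite real_normK ?num_real// !exprMn; lra.
Qed.

Lemma dist2_le_mid p m q : lam * run p m <= `|rise p m| ->
  lam * run m q <= `|rise m q| -> dist2 p m = dist2 m q ->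
  dist2 p q <= theta * dist2 p m.
Proof.
move=> /run_le_cone h1 /run_le_cone h2 e.
apply: le_trans (dist2_tri p m q) _; rewrite -e /theta mulrDl -addrA.
rewrite [X in X + _](_ : _ = dist2 p m + dist2 p m - dist2 p m); last by ring.
move: h1 h2; rewrite -e; set k := (_)^-1 => h1 h2.
have k0 : 0 <= k by rewrite invr_ge0 sqrtr_ge0.
suff : Num.sqrt (run p m * run m q) <= k * dist2 p m by lra.
rewrite -(@ler_pXn2r _ 2) ?nnegrE ?sqrtr_ge0 ?mulr_ge0 ?dist2_ge0//.
by rewrite sqr_sqrtr ?mulr_ge0 ?run_ge0// expr2 ler_pM ?run_ge0.
Qed.

Lemma theta_gt2 : 2 < theta.
Proof.
by rewrite /theta ltrDl divr_gt0// sqrtr_gt0; have := sqr_ge0 lam; lra.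
Qed.

Lemma theta_lt4 : theta < 4.
Proof.
suff : 2 / Num.sqrt (1 + 16 * lam ^+ 2) < 2 by rewrite /theta; lra.
have l0 : 0 < lam ^+ 2 by rewrite exprn_gt0.
have s1 : 1 < Num.sqrt (1 + 16 * lam ^+ 2).
  by rewrite -[X in X < _]sqrtr1 ltr_sqrt; lra.
by rewrite ltr_pdivrMr; lra.
Qed.

End Cone.

(** * Doubling *)

Section Doubling.
Context {R : realType}.
Implicit Types p q r m : heis R.

(** Cut the cube [-1, 1]^3 into cells of side eta: J exceeds their number. *)
Lemma box_pigeonhole (eta : R) : 0 < eta ->
  exists J : nat, forall a b c : nat -> R,
  (forall l, (l < J)%N -> [/\ `|a l| <= 1, `|b l| <= 1 & `|c l| <= 1]) ->
  exists l l', [/\ (l < l' < J)%N, `|a l - a l'| <= eta, `|b l - b l'| <= eta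
    & `|c l - c l'| <= eta].
Proof.
move=> eta0.
pose cell (u : R) : nat := Num.truncn ((u + 1) / eta).
pose N := (Num.truncn (2 / eta)).+1.
have cellN u : `|u| <= 1 -> (cell u < N)%N.
  rewrite ler_norml => /andP[u1 u2]; rewrite ltnS; apply: le_truncn.
  by rewrite ler_pM2r ?invr_gt0//; lra.
have cellE u v : `|u| <= 1 -> `|v| <= 1 -> cell u = cell v -> `|u - v| <= eta.
  rewrite !ler_norml => /andP[u1 u2] /andP[v1 v2].
  have /andP[] : (cell u)%:R <= (u + 1) / eta < (cell u).+1%:R.
    by apply: truncn_itv; rewrite divr_ge0 ?(ltW eta0)//; lra.
  have /andP[] : (cell v)%:R <= (v + 1) / eta < (cell v).+1%:R.
    by apply: truncn_itv; rewrite divr_ge0 ?(ltW eta0)//; lra.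
  move=> + + + + e; rewrite e !ler_pdivlMr// !ltr_pdivrMr//.
  rewrite -natr1; move: ((cell v)%:R) => k *; apply/andP; split; lra.
exists (N * N * N).+1 => a b c abc.
pose f (l : 'I_(N * N * N).+1) : 'I_N * 'I_N * 'I_N :=
  (inord (cell (a l)), inord (cell (b l)), inord (cell (c l))).
have /injectivePn [l [l' ll' e]] : ~~ injectiveb f.
  apply/negP => /injectiveP /leq_card; rewrite !card_prod !card_ord.
  by rewrite ltnn.
have inj k k' : (cell k < N)%N -> (cell k' < N)%N -> inord (cell k) =
  inord (cell k') :> 'I_N -> cell k = cell k'.
  by move=> h h' /(congr1 val); rewrite /= !inordK.
wlog lt : l l' ll' e / (l < l')%N.
  move=> wl; case: (ltngtP l l') => [h|h|h].
  - exact: wl h.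
  - by apply: (wl l' l) => //; rewrite eq_sym.
  - by move: ll'; rewrite (val_inj h) eqxx.
exists l, l'.
have [a1 b1 c1] := abc l (ltn_ord l).
have [a2 b2 c2] := abc l' (ltn_ord l').
move: e; rewrite /f => -[] /inj ea /inj eb /inj ec.
by rewrite lt ltn_ord; split=> //; apply: cellE=> //; auto.
Qed.
End Doubling.

Section HeisDoubling.
Context {R : realType}.
Implicit Types p q r m : heis R.

(** A ball of squared radius S, translated to the origin, lies in a box with
    sides of order sqrt S, sqrt S and S.  Two points in the same cell of a
    subdivision are close for dist2, as the area term is at most
    2 * sqrt S * (eta * sqrt S). *)
Lemma heis_doubling (eps : R) : 0 < eps -> exists J : nat,
  forall p (x : nat -> heis R) (S : R), 0 < S ->
  (forall l, (l < J)%N -> dist2 p (x l) <= S) ->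
  exists l l', (l < l' < J)%N /\ dist2 (x l) (x l') <= eps * S.
Proof.
move=> eps0; pose eta := Num.min 1 (eps / 10).
have eta0 : 0 < eta by rewrite lt_min ltr01 divr_gt0.
have eta1 : eta <= 1 by rewrite ge_min lexx.
have etae : 10 * eta <= eps.
  by rewrite mulrC -ler_pdivlMr// ge_min lexx orbT.
have [J HJ] := box_pigeonhole _ eta0.
exists J => p x S S0 xS.
pose s := Num.sqrt S.
have s0 : 0 < s by rewrite sqrtr_gt0.
have s2 : s ^+ 2 = S by rewrite sqr_sqrtr ?ltW.
have lin (u : R) : u ^+ 2 <= S -> `|u| <= s.
  by rewrite -sqrtr_sqr => /ler_wsqrtr.
have dxS l : (l < J)%N -> `|dx p (x l)| <= s.
  move=> /xS h; apply: lin; apply: le_trans h;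
    apply: le_trans (run_le_dist2 _ _).
  by rewrite lerDl sqr_ge0.
have dyS l : (l < J)%N -> `|dy p (x l)| <= s.
  move=> /xS h; apply: lin; apply: le_trans h;
    apply: le_trans (run_le_dist2 _ _).
  by rewrite lerDr sqr_ge0.
have riS l : (l < J)%N -> `|rise p (x l)| <= S.
  move=> /xS h; have := rise_le_dist2 p (x l); have :=
    normr_ge0 (rise p (x l)); lra.
have [|l [l' [ll' ha hb hc]]] := HJ (fun l => dx p (x l) / s) (fun l =>
  dy p (x l) / s) (fun l => rise p (x l) / S).
  move=> l lJ; rewrite !normrM !normfV (gtr0_norm s0) (gtr0_norm S0).
  by rewrite !ler_pdivrMr// !mul1r dxS ?dyS ?riS.
exists l, l'; split=> //.
have lJ : (l < J)%N by case/andP: ll' => /ltn_trans; apply.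
have ha' : `|dx (x l) (x l')| <= eta * s.
  move: ha; rewrite -mulrBl normrM normfV (gtr0_norm s0) ler_pdivrMr// distrC.
  by congr (`|_| <= _); rewrite /dx; ring.
have hb' : `|dy (x l) (x l')| <= eta * s.
  move: hb; rewrite -mulrBl normrM normfV (gtr0_norm s0) ler_pdivrMr// distrC.
  by congr (`|_| <= _); rewrite /dy; ring.
have hc' : `|rise p (x l') - rise p (x l)| <= eta * S.
  by move: hc; rewrite -mulrBl normrM normfV (gtr0_norm S0) ler_pdivrMr//
    distrC.
have w1 : `|dx p (x l) * dy (x l) (x l')| <= eta * S.
  rewrite normrM -s2; apply: le_trans (ler_pM _ _ (dxS l lJ) hb') _ => //.
  by rewrite expr2 mulrCA.
have w2 : `|dx (x l) (x l') * dy p (x l)| <= eta * S.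
  rewrite normrM -s2; apply: le_trans (ler_pM _ _ ha' (dyS l lJ)) _ => //.
  by rewrite expr2 mulrA.
have hr : `|rise (x l) (x l')| <= 2 * (eta * S).
  have -> : rise (x l) (x l') = (rise p (x l') - rise p (x l))
    - 2^-1 * (dx p (x l) * dy (x l) (x l')) + 2^-1 * (dx (x l) (x l') * dy p
    (x l)).
    by rewrite !riseE /dx /dy; field.
  apply: le_trans (ler_normD _ _) _;
    rewrite normrM (gtr0_norm (_ : 0 < 2^-1))//.
  have := ler_normB (rise p (x l')
    - rise p (x l)) (2^-1 * (dx p (x l) * dy (x l) (x l'))).
  rewrite [X in _ <= _ + X -> _]normrM (gtr0_norm (_ : 0 < 2^-1))//; lra.
have sq (u : R) : `|u| <= eta * s -> u ^+ 2 <= eta * S.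
  move=> h; rewrite -(real_normK (num_real u)).
  apply: (@le_trans _ _ ((eta * s) ^+ 2)).
    by rewrite ler_pXn2r ?nnegrE// mulr_ge0 ?(ltW eta0) ?(ltW s0).
  rewrite exprMn s2 expr2 -mulrA; apply: ler_piMl => //.
  by rewrite mulr_ge0 ?(ltW eta0) ?(ltW S0).
apply: le_trans (dist2_le _ _) _.
have := sq _ ha'; have := sq _ hb'; rewrite /run => h1 h2.
apply: (@le_trans _ _ (10 * eta * S)); last by rewrite ler_pM2r.
lra.
Qed.

End HeisDoubling.

(** * Topology *)

Section Topology.
Context {R : realType}.
Implicit Types p q r m : heis R.

Lemma heis_x_continuous : continuous (@heis_x R).
Proof. by move=> p; apply: (@cvg_comp _ _ _ (fst : R * R * R -> R * R) fst);
  [exact: cvg_fst|exact: cvg_fst]. Qed.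

Lemma heis_y_continuous : continuous (@heis_y R).
Proof. by move=> p; apply: (@cvg_comp _ _ _ (fst : R * R * R -> R * R) snd);
  [exact: cvg_fst|exact: cvg_snd]. Qed.

Lemma heis_z_continuous : continuous (@heis_z R).
Proof. by move=> p; exact: cvg_snd. Qed.

Lemma rise_continuous p : continuous (rise p).
Proof.
move=> q; rewrite (_ : rise p = fun q => heis_z q - heis_z p
  - 2^-1 * (heis_x p * heis_y q - heis_x q * heis_y p)); last
  by apply/funext => r; rewrite riseE.
apply: cvgB; first by apply: cvgB; [exact: heis_z_continuous|exact: cvg_cst].
apply: cvgMr; apply: cvgB; first by apply: cvgMr; exact: heis_y_continuous.
by apply: cvgMl; exact: heis_x_continuous.
Qed.

Lemma dist2_continuous p : continuous (dist2 p).
Proof.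
move=> q; apply: (@continuous_comp _ _ _ (fun q =>
  run p q ^+ 2 + (4 * rise p q) ^+ 2) (@Num.sqrt R));
  last exact: sqrt_continuous.
rewrite /run /dx /dy /=.
have hx : heis_x r - heis_x p @[r --> q] --> heis_x q - heis_x p.
  by apply: cvgB; [exact: heis_x_continuous|exact: cvg_cst].
have hy : heis_y r - heis_y p @[r --> q] --> heis_y q - heis_y p.
  by apply: cvgB; [exact: heis_y_continuous|exact: cvg_cst].
have hz : 4 * rise p r @[r --> q] --> 4 * rise p q.
  by apply: cvgMr; exact: rise_continuous.
apply: cvgD; last exact: (cvgM hz hz).
have h : (heis_x r - heis_x p) ^+ 2 + (heis_y r
  - heis_y p) ^+ 2 @[r --> q] --> (heis_x q - heis_x p) ^+ 2 + (heis_y q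
  - heis_y p) ^+ 2.
  by apply: cvgD; [exact: (cvgM hx hx)|exact: (cvgM hy hy)].
exact: (cvgM h h).
Qed.

(** Together with the continuity of dist2: the Koranyi balls generate the
    Euclidean topology. *)
Lemma dist2_nbhs p (W : set (heis R)) : nbhs p W ->
  exists2 d : R, 0 < d & forall r, dist2 p r < d -> W r.
Proof.
move=> /(@nbhs_ballP R (R * R * R)%type p W)[/= e e0 eW].
(* L controls the area term between p and r by the size of p. *)
pose L := `|heis_x p| + `|heis_y p| + 1.
have L1 : 1 <= L by rewrite lerDr addr_ge0.
pose d := Num.min e (e / L).
have d0 : 0 < d by rewrite lt_min e0 divr_gt0 // (lt_le_trans ltr01).
have de : d <= e by rewrite ge_min lexx.
have dL : d * L <= e
  by rewrite -ler_pdivlMr ?(lt_le_trans ltr01)// ge_min lexx orbT.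
exists (Num.min (d ^+ 2) d).
  by rewrite lt_min exprn_gt0.
move=> r; rewrite lt_min => /andP[h1 h2].
have dxl : `|dx p r| < d.
  rewrite -(@ltr_pXn2r _ 2) ?nnegrE ?(ltW d0)// real_normK ?num_real//.
  apply: le_lt_trans h1; apply: le_trans (run_le_dist2 _ _).
  by rewrite lerDl sqr_ge0.
have dyl : `|dy p r| < d.
  rewrite -(@ltr_pXn2r _ 2) ?nnegrE ?(ltW d0)// real_normK ?num_real//.
  apply: le_lt_trans h1; apply: le_trans (run_le_dist2 _ _).
  by rewrite lerDr sqr_ge0.
have rl : `|rise p r| < d.
  have := rise_le_dist2 p r; have := normr_ge0 (rise p r); lra.
have dzl : `|heis_z r - heis_z p| < e.
  have -> : heis_z r - heis_z p = rise p r + (2^-1 * (heis_x p * dy p r)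
    - 2^-1 * (heis_y p * dx p r)).
    by rewrite riseE /dx /dy; field.
  have a1 : `|heis_x p * dy p r| <= `|heis_x p| * d.
    by rewrite normrM ler_wpM2l// ltW.
  have a2 : `|heis_y p * dx p r| <= `|heis_y p| * d.
    by rewrite normrM ler_wpM2l// ltW.
  apply: le_lt_trans (ler_normD _ _) _.
  have := ler_normB (2^-1 * (heis_x p * dy p r)) (2^-1 * (heis_y p * dx p r)).
  rewrite !(normrM 2^-1) (gtr0_norm (_ : 0 < 2^-1))//.
  have := mulr_ge0 (normr_ge0 (heis_x p)) (ltW d0).
  have := mulr_ge0 (normr_ge0 (heis_y p)) (ltW d0).
  move: dL; rewrite /L; lra.
apply: eW; split; [split|]; rewrite /ball/= distrC.
- exact: lt_le_trans dxl de.
- exact: lt_le_trans dyl de.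
- exact: dzl.
Qed.

Lemma open_rise_gt p (c : R) : open [set q | c < rise p q].
Proof.
by apply: (open_comp (D := [set x | c < x])) => [q _|];
  [exact: rise_continuous|exact: open_gt].
Qed.

Lemma open_rise_lt p (c : R) : open [set q | rise p q < c].
Proof.
by apply: (open_comp (D := [set x | x < c])) => [q _|];
  [exact: rise_continuous|exact: open_lt].
Qed.

Lemma open_dist2_lt p (c : R) : open [set q | dist2 p q < c].
Proof.
by apply: (open_comp (D := [set x | x < c])) => [q _|];
  [exact: dist2_continuous|exact: open_lt].
Qed.

Lemma open_dist2_closer p q : open [set r | dist2 p r < dist2 q r].
Proof.
rewrite (_ : mkset _ = [set r | dist2 p r - dist2 q r < 0]); last first.
  by apply/seteqP; split=> r /=; rewrite subr_lt0.
apply: (open_comp (f := fun r => dist2 p r - dist2 q r) (D :=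
  [set x | x < 0])) => [r _|]; last exact: open_lt.
by apply: cvgB; exact: dist2_continuous.
Qed.

(** The common point of U and V is found in E itself: sets defined by rises from
    several points of E may well overlap elsewhere. *)
Lemma connected_meet (T : topologicalType) (E U V : set T) : connected E ->
  open U -> open V -> E `<=` U `|` V -> E `&` U !=set0 -> E `&` V !=set0 ->
  E `&` (U `&` V) !=set0.
Proof.
move=> cE oU oV EUV U0 [v [Ev Vv]].
apply: contrapT => no.
have eq : E `&` U = E `&` ~` V.
  apply/seteqP; split=> x [Ex h]; split=> //.
    by move=> Vx; apply: no; exists x.
  by case: (EUV x Ex).
have : E `&` U = E.
  apply: cE => //; first by exists U.
  by exists (~` V) => //; exact: open_closedC.
by move=> /seteqP[_ /(_ v Ev)]; rewrite eq => -[].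
Qed.
End Topology.

(** * The order of a connected vertical curve *)

Section Order.
Context {R : realType} (lam : R).
Hypothesis lam0 : 0 < lam.
Variable E : set (heis R).
Hypothesis cE : connected E.
Hypothesis vE : vertical_curve lam E.
Implicit Types p q r m : heis R.

Lemma curve_cone p q : E p -> E q -> lam * run p q <= `|rise p q|.
Proof.
move=> Ep Eq; have [v hv <-] := vE p Ep q Eq.
by rewrite /run /rise -mulV_xE -mulV_yE mulKg.
Qed.

Lemma curve_rise0 p q : E p -> E q -> rise p q = 0 -> p = q.
Proof.
move=> Ep Eq h; apply: heis_eq => //; apply/eqP; rewrite eq_le run_ge0 andbT.
by rewrite -(pmulr_rle0 _ lam0); move: (curve_cone p q Ep Eq); rewrite h normr0.
Qed.

Lemma curve_below p q : E p -> E q -> 0 <= rise p q -> below lam p q.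
Proof. by move=> Ep Eq h; move: (curve_cone p q Ep Eq); rewrite ger0_norm. Qed.

(** If p < q < r < p, the points below p and above q, and the points above p or
    below q, would form an open partition of E, with r in the first part and p
    in the second. *)
Lemma curve_lt_trans p q r : E p -> E q -> E r ->
  0 < rise p q -> 0 < rise q r -> 0 < rise p r.
Proof.
move=> Ep Eq Er pq qr; rewrite ltNge; apply/negP; rewrite le_eqVlt =>
  /orP[/eqP pr|rp].
  move: pq; rewrite (curve_rise0 p r Ep Er pr) riseC; move: qr; lra.
pose U := [set x | rise p x < 0] `&` [set x | 0 < rise q x].
pose V := [set x | 0 < rise p x] `|` [set x | rise q x < 0].
have [|||||x [Ex [/= [xp qx] [px|xq]]]] := @connected_meet _ E U V cE.
- by apply: openI; [exact: open_rise_lt|exact: open_rise_gt].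
- by apply: openU; [exact: open_rise_gt|exact: open_rise_lt].
- move=> x Ex; rewrite /U/V/=.
  have [px|px|px] := ltrgtP 0 (rise p x).
  + by right; left.
  + have [qx|qx|qx] := ltrgtP 0 (rise q x).
    * by left.
    * by right; right.
    * by move: px; rewrite -(curve_rise0 q x Eq Ex (esym qx)); move: pq; lra.
  + by right; right;
    rewrite -(curve_rise0 p x Ep Ex (esym px)) /= riseC oppr_lt0.
- by exists r.
- by exists p; split=> //; right => /=; rewrite riseC oppr_lt0.
- by have := lt_trans xp px; rewrite ltxx.
- by have := lt_trans xq qx; rewrite ltxx.
Qed.

Lemma curve_le_trans p q r : E p -> E q -> E r ->
  0 <= rise p q -> 0 <= rise q r -> 0 <= rise p r.
Proof.
move=> Ep Eq Er; rewrite le_eqVlt =>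
  /orP[/eqP/esym/(curve_rise0 p q Ep Eq) ->//|pq].
rewrite le_eqVlt => /orP[/eqP/esym/(curve_rise0 q r Eq Er) <-|qr];
  first exact: ltW.
by apply: ltW; exact: (curve_lt_trans p q r).
Qed.

Lemma curve_lt_le_trans p q r : E p -> E q -> E r ->
  0 < rise p q -> 0 <= rise q r -> 0 < rise p r.
Proof.
move=> Ep Eq Er pq.
rewrite le_eqVlt => /orP[/eqP/esym/(curve_rise0 q r Eq Er) <-//|qr].
exact: (curve_lt_trans p q r).
Qed.

Lemma rise_not_lt p q : ~~ (0 < rise p q) -> 0 <= rise q p.
Proof. by rewrite -leNgt (riseC p q) oppr_ge0. Qed.

(** Bounded turning: compare the rise from q to q' with the rise from p to q',
    then with the rise from p to r; in the cone, rise and dist2 are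
    comparable. *)
Lemma curve_nested p q q' r : E p -> E q -> E q' -> E r ->
  0 <= rise p q -> 0 <= rise q q' -> 0 <= rise q' r ->
  dist2 q q' <= turning lam * dist2 p r.
Proof.
move=> Ep Eq Eq' Er pq qq q'r.
have pq' : 0 <= rise p q' by exact: (curve_le_trans p q q').
have pr : 0 <= rise p r by exact: (curve_le_trans p q' r).
have K1 := rise_turning_ge1 lam; have A4 := cone_ratio_ge4 lam lam0.
have h1 : rise q q' <= rise_turning lam * rise p q'.
  by apply: rise_le_r => //; exact: curve_below.
have h2 : rise p q' <= rise_turning lam * rise p r.
  by apply: rise_le_l q'r _ => //; exact: curve_below.
apply: le_trans (dist2_le_rise _ lam0 _ _ (curve_cone _ _ Eq Eq')) _.
rewrite (ger0_norm qq) /turning -mulrA ler_pM2l; last by lra.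
apply: le_trans h1 _; rewrite expr2 -mulrA ler_pM2l; last by lra.
apply: le_trans h2 _; rewrite ler_pM2l; last by lra.
have := rise_le_dist2 p r; rewrite ger0_norm//; move: pr; lra.
Qed.

(** Otherwise the part of E in U would be open and closed in E. *)
Lemma side_not_isolated p (U V : set (heis R)) (d : R) : E p -> 0 < d ->
  open U -> open V -> (forall x, E x -> [\/ U x, V x | x = p]) ->
  (forall x, E x -> U x -> ~ V x) -> E `&` U !=set0 ->
  exists r, [/\ E r, U r & dist2 p r < d].
Proof.
move=> Ep d0 oU oV cov dis U0.
have [|||||x [Ex [/= Ux [/(dis x Ex Ux)//|xp]]]] :=
  @connected_meet _ E U (V `|` [set r | dist2 p r < d]) cE.
- exact: oU.
- by apply: openU => //; exact: open_dist2_lt.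
- move=> x Ex; case: (cov x Ex) => [Ux|Vx|->]; first by left.
    by right; left.
  by right; right; rewrite /= dist2_self.
- exact: U0.
- by exists p; split=> //; right; rewrite /= dist2_self.
- by exists x.
Qed.

Lemma curve_trichotomy p x : E p -> E x ->
  [\/ 0 < rise p x, rise p x < 0 | x = p].
Proof.
move=> Ep Ex; have [h|h|h] := ltrgtP 0 (rise p x).
- exact: Or31.
- exact: Or32.
- by apply: Or33; rewrite (curve_rise0 p x).
Qed.

(** Otherwise the points below q and the points above p would split E. *)
Lemma curve_dense p q : E p -> E q -> 0 < rise p q ->
  exists m, [/\ E m, 0 < rise p m & 0 < rise m q].
Proof.
move=> Ep Eq pq.
have [|||||x [Ex [/= px xq]]] :=
  @connected_meet _ E [set r | 0 < rise p r] [set r | rise q r < 0] cE.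
- exact: open_rise_gt.
- exact: open_rise_lt.
- move=> x Ex /=; case: (curve_trichotomy p x Ep Ex) => [|px|->]; [by left| |].
    right; rewrite riseC oppr_lt0; apply: (curve_lt_trans x p q) => //.
    by rewrite riseC oppr_gt0.
  by right; rewrite riseC oppr_lt0.
- by exists q.
- by exists p; split=> //=; rewrite riseC oppr_lt0.
- by exists x; split=> //; rewrite (riseC q x) oppr_gt0.
Qed.

(** * Parametrization by the inverse of an increasing function *)

Section Parametrize.
Variable tau : heis R -> R.
Hypothesis tau_cont : {within E, continuous tau}.
Hypothesis tau_inc : forall p q, E p -> E q -> 0 < rise p q -> tau p < tau q.

Lemma tau_lt p q : E p -> E q -> tau p < tau q -> 0 < rise p q.
Proof.
move=> Ep Eq pq; case: (curve_trichotomy p q Ep Eq) => // [qp|qp].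
  have := tau_inc q p Eq Ep; rewrite riseC oppr_gt0 => /(_ qp); move: pq; lra.
by move: pq; rewrite qp ltxx.
Qed.

Lemma tau_inj p q : E p -> E q -> tau p = tau q -> p = q.
Proof.
move=> Ep Eq pq; case: (curve_trichotomy p q Ep Eq) => // [qp|qp].
  by have := tau_inc p q Ep Eq qp; rewrite pq ltxx.
have := tau_inc q p Eq Ep; rewrite riseC oppr_gt0 => /(_ qp); rewrite pq ltxx.
by [].
Qed.

(** On each side where E has points, [side_not_isolated] gives a point r of E
    close to p; whatever tau maps between tau p and tau r lies on the arc from p
    to r, hence close to p by bounded turning. *)
Lemma tau_near p (d : R) : E p -> 0 < d -> exists2 e : R, 0 < e &
  forall r, E r -> `|tau r - tau p| < e -> dist2 p r < d.
Proof.
move=> Ep d0.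
have K1 := turning_ge1 lam lam0.
have K0 : 0 < turning lam by lra.
have [e1 e10 h1] : exists2 e : R, 0 < e & forall r, E r -> 0 < rise p r ->
  tau r - tau p < e -> dist2 p r < d.
  have [ne|em] := pselect (E `&` [set r | 0 < rise p r] !=set0); last first.
    by exists 1 => // r Er pr; exfalso; apply: em; exists r.
  have [||||||r [Er /= pr rd]] :=
    side_not_isolated p [set r | 0 < rise p r] [set r | rise p r < 0] (d /
    turning lam) Ep.
  - by rewrite divr_gt0.
  - exact: open_rise_gt.
  - exact: open_rise_lt.
  - by move=> x Ex; apply: curve_trichotomy.
  - by move=> x Ex /=; lra.
  - exact: ne.
  exists (tau r - tau p); first by rewrite subr_gt0; exact: tau_inc.
  move=> x Ex px; rewrite ltrD2r => /(tau_lt x r Ex Er) xr.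
  move: rd; rewrite ltr_pdivlMr// mulrC; apply: le_lt_trans.
  by apply: curve_nested; rewrite ?rise_self// ltW.
have [e2 e20 h2] : exists2 e : R, 0 < e & forall r, E r -> rise p r < 0 ->
  tau p - tau r < e -> dist2 p r < d.
  have [ne|em] := pselect (E `&` [set r | rise p r < 0] !=set0); last first.
    by exists 1 => // r Er pr; exfalso; apply: em; exists r.
  have [||||||r [Er /= pr rd]] :=
    side_not_isolated p [set r | rise p r < 0] [set r | 0 < rise p r] (d /
    turning lam) Ep.
  - by rewrite divr_gt0.
  - exact: open_rise_lt.
  - exact: open_rise_gt.
  - by move=> x Ex; case: (curve_trichotomy p x Ep Ex);
    [apply: Or32|apply: Or31|apply: Or33].
  - by move=> x Ex /=; lra.
  - exact: ne.
  have rp : 0 < rise r p by rewrite riseC oppr_gt0.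
  exists (tau p - tau r); first by rewrite subr_gt0; exact: tau_inc.
  move=> x Ex xp; rewrite ltrD2l ltrN2 => /(tau_lt r x Er Ex) rx.
  move: rd; rewrite ltr_pdivlMr// mulrC (dist2C r) (dist2C x);
    apply: le_lt_trans.
  apply: curve_nested; rewrite ?rise_self// ltW//.
  by rewrite riseC oppr_gt0.
exists (Num.min e1 e2); first by rewrite lt_min e10.
move=> r Er; rewrite lt_min !ltr_norml => /andP[/andP[a1 b1] /andP[a2 b2]].
case: (curve_trichotomy p r Ep Er) => [pr|pr|->].
- exact: h1.
- by apply: h2 => //; lra.
- by rewrite dist2_self.
Qed.

Definition inv_param (t : R) : heis R := xget (heis_one R) [set p | E p /\
  tau p = t].

Lemma inv_paramP t : (tau @` E) t -> E (inv_param t) /\ tau (inv_param t) = t.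
Proof.
move=> [p Ep pt]; rewrite /inv_param.
by case: xgetP => [q _ [Eq <-]//|/(_ p)]; case.
Qed.

Lemma inv_paramK p : E p -> inv_param (tau p) = p.
Proof.
move=> Ep; have [|h1 h2] := inv_paramP (tau p); first by exists p.
exact: tau_inj.
Qed.

(** The image of tau is connected, hence an interval; [tau_near] is the
    continuity of the inverse. *)
Lemma curve_parametrization :
  [/\ is_interval (tau @` E), homeo_onto (tau @` E) E inv_param &
      increasing_param lam (tau @` E) inv_param].
Proof.
split.
- apply/connected_intervalP; exact: connected_continuous_connected.
- split.
  + split.
    * by move=> t /inv_paramP[].
    * move=> t u; rewrite !inE => /inv_paramP[_ ht] /inv_paramP[_ hu] e.
      by rewrite -ht -hu e.
    * by move=> p Ep; exists (tau p); [exists p|exact: inv_paramK].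
  + apply/subspace_continuousP => t It W hW.
    have [Et tt] := inv_paramP t It.
    have [d d0 dW] := dist2_nbhs _ _ hW.
    have [e e0 ed] := tau_near _ d Et d0.
    rewrite /nbhs/= /within/=; near=> u => Iu.
    have [Eu uu] := inv_paramP u Iu.
    apply/dW/ed => //; rewrite uu tt distrC.
    by near: u; exact: cvgr_dist_lt.
  + exists tau => //.
    by move=> t; rewrite inE => /inv_paramP[].
- move=> s t Is It st.
  have [Es ss] := inv_paramP s Is; have [Et tt] := inv_paramP t It.
  have h : 0 < rise (inv_param s) (inv_param t) by apply: tau_lt => //;
    rewrite ss tt.
  exists ((inv_param s)^-1 * inv_param t)%g; last by rewrite mulVKg.
  split; last exact: ltW.
  rewrite /VCone/= mulV_xE mulV_yE; exact: curve_cone.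
Unshelve. all: by end_near.
Qed.
End Parametrize.

End Order.

(** * An increasing function on an arbitrary curve *)

Section Continuity.
Context {R : realType}.
Variable E : set (heis R).

Lemma within_continuous_dist2 (tau : heis R -> R) :
  (forall p (e : R), E p -> 0 < e -> exists2 d : R, 0 < d &
     forall r, E r -> dist2 p r < d -> `|tau p - tau r| < e) ->
  {within E, continuous tau}.
Proof.
move=> H; apply/subspace_continuousP => p Ep.
apply/cvgrPdist_lt => e e0.
have [d d0 dE] := H p e Ep e0.
have : nbhs p [set r | dist2 p r < d].
  apply: (open_nbhs_nbhs (A := [set r | dist2 p r < d])).
  by split; [exact: open_dist2_lt|rewrite /= dist2_self].
by apply: (@filterS _ (nbhs p) (nbhs_filter p)) => r rd Er; exact: dE.
Qed.

(** Choose a point of E in every box with rational centre and rational size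
    that meets E. *)
Lemma heis_dense_seq p0 : E p0 -> exists q : nat -> heis R,
  (forall n, E (q n)) /\
  (forall W : set (heis R), open W -> E `&` W !=set0 -> exists n, W (q n)).
Proof.
move=> Ep0.
pose box (u : rat * rat * rat * rat) : set (heis R) :=
  [set p | [/\ `|heis_x p - ratr u.1.1.1| < ratr u.2,
               `|heis_y p - ratr u.1.1.2| < ratr u.2 &
               `|heis_z p - ratr u.1.2| < ratr u.2]].
pose q n : heis R := if unpickle n is Some u then xget p0 (E `&` box u) else p0.
exists q; split.
  move=> n; rewrite /q; case: (unpickle n) => // u.
  by case: xgetP => [p _ []|].
move=> W oW [p [Ep Wp]].
have /(@nbhs_ballP R (R * R * R)%type p W)[/= e e0 eW] : nbhs p W
  by exact: open_nbhs_nbhs.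
have [d] : exists d : rat, ratr d \in `]0, (e / 2)[ by apply: rat_in_itvoo;
  rewrite divr_gt0.
rewrite in_itv/= => /andP[d0 de].
have apx (x : R) : exists a : rat, `|x - ratr a| < ratr d.
  have [a] : exists a : rat, ratr a \in `]x, (x + ratr d)[
    by apply: rat_in_itvoo; rewrite ltrDl.
  by rewrite in_itv/= => /andP[h1 h2]; exists a; rewrite ltr_norml;
    apply/andP; split; lra.
have [a ha] := apx (heis_x p); have [b hb] := apx (heis_y p); have [c hc] :=
  apx (heis_z p).
exists (pickle (a, b, c, d)); rewrite /q pickleK.
case: xgetP => [r _ [Er [/= ra rb rc]]|/(_ p)]; last by case.
(* The chosen point r and p lie in the same box of size d < e / 2. *)
have near2 (x y z : R) : `|x - z| < ratr d -> `|y - z| < ratr d -> `|x - y| < e.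
  by rewrite !ltr_norml => /andP[? ?] /andP[? ?]; apply/andP; split; lra.
by apply: eW; split; [split|]; rewrite /ball/=;
  [apply: near2 ra|apply: near2 rb|apply: near2 rc].
Qed.

End Continuity.

Section GlobalParameter.
Context {R : realType} (lam : R).
Hypothesis lam0 : 0 < lam.
Variable E : set (heis R).
Hypothesis cE : connected E.
Hypothesis vE : vertical_curve lam E.
Implicit Types p q r m : heis R.

Lemma curve_nested_kor p q q' r : E p -> E q -> E q' -> E r ->
  0 <= rise p q -> 0 <= rise q q' -> 0 <= rise q' r ->
  kor_dist q q' <= turning lam * kor_dist p r.
Proof.
move=> Ep Eq Eq' Er pq qq q'r; have K1 := turning_ge1 lam lam0.
have K0 : 0 <= turning lam by lra.
rewrite -(@ler_pXn2r _ 2) ?nnegrE ?(mulr_ge0 K0 (kor_dist_ge0 _ _))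
  ?kor_dist_ge0//.
have := curve_nested lam lam0 E cE vE p q q' r Ep Eq Eq' Er pq qq q'r.
rewrite exprMn !sqr_kor_dist => /le_trans; apply.
by rewrite ler_wpM2r ?dist2_ge0// expr2 ler_peMr.
Qed.

(** The distance to q need not increase along the curve, so its supremum over
    the arc from q to p is used; it is truncated at 1 to make the weighted sum
    converge.  The value 0 makes the set nonempty when p does not follow q. *)
Definition reach_set q p : set R := [set t | t = 0 \/
  exists r, [/\ E r, 0 < rise q r, 0 <= rise r p & t =
    Num.min 1 (kor_dist q r)]].
Definition reach q p : R := sup (reach_set q p).

Lemma reach_has_sup q p : has_sup (reach_set q p).
Proof.
split; first by exists 0; left.
exists 1 => t [->//|[r [_ _ _ ->]]]; by rewrite ge_min lexx.
Qed.

Lemma reach_ub q p t : reach_set q p t -> t <= reach q p.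
Proof. by move=> h; apply: ub_le_sup => //; case: (reach_has_sup q p). Qed.

Lemma reach_le q p t : (forall u, reach_set q p u -> u <= t) -> reach q p <= t.
Proof. by move=> h; apply: ge_sup => //; exists 0; left. Qed.

Lemma reach_ge0 q p : 0 <= reach q p.
Proof. by apply: reach_ub; left. Qed.

Lemma reach_le1 q p : reach q p <= 1.
Proof. by apply: reach_le => t [->//|[r [_ _ _ ->]]]; rewrite ge_min lexx. Qed.

Lemma reach_mono q p p' : E p -> E p' -> 0 <= rise p p' -> reach q p <=
  reach q p'.
Proof.
move=> Ep Ep' pp; apply: reach_le => t [->|[r [Er qr rp ->]]];
  first exact: reach_ge0.
by apply: reach_ub; right; exists r; split=> //;
  exact: (curve_le_trans lam lam0 E cE vE r p p').
Qed.

Lemma reach_eq0 q p : E q -> E p -> rise q p <= 0 -> reach q p = 0.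
Proof.
move=> Eq Ep qp; apply/eqP; rewrite eq_le reach_ge0 andbT.
apply: reach_le => t [->//|[r [Er qr rp ->]]].
have := curve_lt_le_trans lam lam0 E cE vE q r p Eq Er Ep qr rp; lra.
Qed.

Lemma reach_gt0 q p : E q -> E p -> 0 < rise q p -> 0 < reach q p.
Proof.
move=> Eq Ep qp; apply: (@lt_le_trans _ _ (Num.min 1 (kor_dist q p))).
  by rewrite lt_min ltr01 kor_dist_gt0 ?gt_eqF.
by apply: reach_ub; right; exists p; rewrite rise_self.
Qed.

(** A point r that is reached from p' but not from p lies between p and p', so
    it is close to p by bounded turning.  If q follows p as well, then
    the distance from q to r is itself controlled by that from p to p'. *)
Lemma reach_lip q p p' : E q -> E p -> E p' -> 0 <= rise p p' ->
  reach q p' <= reach q p + turning lam * kor_dist p p'.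
Proof.
move=> Eq Ep Ep' pp.
have K1 := turning_ge1 lam lam0.
have K0 : 0 <= turning lam by lra.
have Kd0 := mulr_ge0 K0 (kor_dist_ge0 p p').
have nested := curve_nested_kor p _ _ p' Ep _ _ Ep'.
apply: reach_le => t [->|[r [Er qr rp' ->]]]; first
  by rewrite addr_ge0 ?reach_ge0.
have [pr|/rise_not_lt rp] := boolP (0 < rise p r); last first.
  by apply: ler_wpDr => //; apply: reach_ub; right; exists r.
have [qp|/rise_not_lt pq] := boolP (0 < rise q p); last first.
  apply: ler_wpDl; first exact: reach_ge0.
  rewrite ge_min; apply/orP; right.
  by apply: nested => //; exact: ltW.
have h1 : kor_dist p r <= turning lam * kor_dist p p'.
  by apply: nested; rewrite ?rise_self// ltW.
have h2 : Num.min 1 (kor_dist q p) <= reach q p.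
  by apply: reach_ub; right; exists p; rewrite rise_self.
have := kor_dist_tri q p r; move: h2.
by rewrite !minEle; case: ifP => _; case: ifP => h3; lra.
Qed.

Section Weights.
Variable s : nat -> heis R.
Hypothesis Es : forall n, E (s n).
Hypothesis s_dense : forall W : set (heis R), open W -> E `&` W !=set0 ->
  exists n, W (s n).

Definition weight (n : nat) : R := 2^-1 ^+ n.+1.
Definition partial_param (n : nat) p : R :=
  \sum_(i < n) weight i * reach (s i) p.
Definition series_param p : R := limn (partial_param^~ p).

Lemma weight_gt0 n : 0 < weight n.
Proof. by rewrite exprn_gt0. Qed.

Lemma sum_weight n : \sum_(i < n) weight i <= 1.
Proof.
suff -> : \sum_(i < n) weight i = 1 - 2^-1 ^+ n
  by rewrite lerBlDr lerDl exprn_ge0.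
elim: n => [|n IH]; first by rewrite big_ord0 expr0 subrr.
by rewrite big_ord_recr/= IH /weight exprS; field.
Qed.

Lemma partial_param_cvg p : cvgn (partial_param^~ p).
Proof.
apply: nondecreasing_is_cvgn.
  apply/nondecreasing_seqP => n; rewrite /partial_param big_ord_recr/= lerDl.
  by rewrite mulr_ge0 ?reach_ge0 ?(ltW (weight_gt0 _)).
exists 1 => _ [n _ <-]; apply: le_trans (sum_weight n).
by apply: ler_sum => i _; rewrite ler_piMr ?reach_le1 ?(ltW (weight_gt0 _)).
Qed.

Lemma partial_paramB_cvg p p' : partial_param n p'
  - partial_param n p @[n --> \oo] --> series_param p' - series_param p.
Proof. by apply: cvgB; exact: partial_param_cvg. Qed.

(** The dense sequence has a term strictly between p and p'; its reach
    vanishes at p and not at p'. *)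
Lemma series_param_inc p p' : E p -> E p' -> 0 < rise p p' ->
  series_param p < series_param p'.
Proof.
move=> Ep Ep' pp.
have [m [Em pm mp']] := curve_dense lam lam0 E cE vE p p' Ep Ep' pp.
have [||n [/= pn np']] := s_dense ([set r | 0 < rise p r] `&`
  [set r | rise p' r < 0]).
- by apply: openI; [exact: open_rise_gt|exact: open_rise_lt].
- by exists m; split=> //; split=> //=; rewrite riseC oppr_lt0.
have np : 0 < rise (s n) p' by rewrite (riseC p' (s n)) oppr_gt0.
have c0 : 0 < weight n * reach (s n) p'
  by rewrite mulr_gt0 ?weight_gt0// reach_gt0.
rewrite -subr_gt0; apply: lt_le_trans c0 _.
rewrite -(cvg_lim (@Rhausdorff R) (partial_paramB_cvg p p')).
apply: limr_ge; first exact: cvgP (partial_paramB_cvg p p').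
near=> k.
have nk : (n < k)%N by near: k; exact: nbhs_infty_gt.
rewrite /partial_param -sumrB (bigD1 (Ordinal nk))//=.
rewrite (reach_eq0 (s n) p) ?(Es n)//; last by rewrite riseC oppr_le0 ltW.
rewrite mulr0 subr0 lerDl; apply: sumr_ge0 => i _.
by rewrite -mulrBr mulr_ge0 ?(ltW (weight_gt0 _))// subr_ge0 reach_mono// ltW.
Unshelve. all: by end_near.
Qed.

Lemma series_param_lip_le p p' : E p -> E p' -> 0 <= rise p p' ->
  series_param p' - series_param p <= turning lam * kor_dist p p'.
Proof.
move=> Ep Ep' pp.
rewrite -(cvg_lim (@Rhausdorff R) (partial_paramB_cvg p p')).
have K1 := turning_ge1 lam lam0.
have K0 : 0 <= turning lam by lra.
have Kd0 := mulr_ge0 K0 (kor_dist_ge0 p p').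
apply: limr_le; first exact: cvgP (partial_paramB_cvg p p').
near=> k; rewrite /partial_param -sumrB.
apply: (@le_trans _ _ (\sum_(i < k) weight i * (turning lam * kor_dist p p'))).
  apply: ler_sum => i _; rewrite -mulrBr ler_pM2l ?weight_gt0//.
  by rewrite lerBlDl reach_lip.
by rewrite -mulr_suml ler_piMl// sum_weight.
Unshelve. all: by end_near.
Qed.

Lemma series_param_lip p p' : E p -> E p' ->
  `|series_param p - series_param p'| <= turning lam * kor_dist p p'.
Proof.
move=> Ep Ep'.
case: (curve_trichotomy lam lam0 E vE p p' Ep Ep') => h.
- rewrite distrC ger0_norm ?series_param_lip_le ?(ltW h)//.
  by rewrite subr_ge0 ltW// series_param_inc.
- have h' : 0 < rise p' p by rewrite riseC oppr_gt0.
  rewrite ger0_norm ?subr_ge0 ?(ltW (series_param_inc _ _ _ _ _))// kor_distC.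
  by rewrite series_param_lip_le// ltW.
- by rewrite h subrr normr0 (mulr_ge0 _ (kor_dist_ge0 _ _))//; have :=
  turning_ge1 lam lam0; lra.
Qed.

Lemma series_param_continuous : {within E, continuous series_param}.
Proof.
have K1 := turning_ge1 lam lam0.
have K0 : 0 < turning lam by lra.
apply: within_continuous_dist2 => p e Ep e0.
exists ((e / turning lam) ^+ 2); first by rewrite exprn_gt0 ?divr_gt0.
move=> r Er h; apply: le_lt_trans (series_param_lip p r Ep Er) _.
rewrite mulrC -ltr_pdivlMr// -(@ltr_pXn2r _ 2) ?nnegrE ?kor_dist_ge0//.
  by rewrite sqr_kor_dist.
by rewrite divr_ge0 ?ltW.
Qed.

End Weights.

Lemma curve_global_parameter : exists tau : heis R -> R,
  {within E, continuous tau} /\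
  (forall p q, E p -> E q -> 0 < rise p q -> tau p < tau q).
Proof.
have [[p0 Ep0]|E0] := pselect (E !=set0); last first.
  exists (fun=> 0); split.
    by apply: continuous_subspaceT => x; exact: cvg_cst.
  by move=> p q Ep; exfalso; apply: E0; exists p.
have [s [Es sd]] := heis_dense_seq E p0 Ep0.
exists (series_param s); split; first exact: series_param_continuous.
exact: series_param_inc.
Qed.

End GlobalParameter.

(** * Equidistant points and bisections *)

Section Midpoints.
Context {R : realType} (lam : R).
Hypothesis lam0 : 0 < lam.
Implicit Types p q r m : heis R.

Definition is_midpoint (E : set (heis R)) p q m :=
  [/\ E m, 0 < rise p m, 0 < rise m q & dist2 p m = dist2 m q].

(** Without equidistant point, E would be split into the points closer to p (or
    below p) and the points closer to q (or above q). *)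
Lemma curve_midpoint (E : set (heis R)) p q : connected E ->
  vertical_curve lam E -> E p -> E q -> 0 < rise p q ->
  exists m, is_midpoint E p q m.
Proof.
move=> cE vE Ep Eq pq; apply: contrapT => no.
have qp : rise q p < 0 by rewrite riseC oppr_lt0.
have d0 : 0 < dist2 p q by rewrite dist2_gt0// gt_eqF.
pose A := [set r | rise p r < 0] `|` ([set r | rise q r < 0] `&`
  [set r | dist2 p r < dist2 q r]).
pose B := [set r | 0 < rise q r] `|` ([set r | 0 < rise p r] `&`
  [set r | dist2 q r < dist2 p r]).
have [|||||x [Ex []]] := @connected_meet _ E A B cE.
- apply: openU; first exact: open_rise_lt.
  by apply: openI; [exact: open_rise_lt|exact: open_dist2_closer].
- apply: openU; first exact: open_rise_gt.
  by apply: openI; [exact: open_rise_gt|exact: open_dist2_closer].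
- move=> x Ex; rewrite /A /B /=.
  have [px|px|->] := curve_trichotomy lam lam0 E vE p x Ep Ex; [|left;
    by left|].
    have [qx|qx|->] := curve_trichotomy lam lam0 E vE q x Eq Ex; [right;
      by left| |].
      have [h|h|h] := ltrgtP (dist2 p x) (dist2 q x).
      - by left; right.
      - by right; right.
      - exfalso; apply: no; exists x.
        by split=> //; [rewrite riseC oppr_gt0|rewrite (dist2C q x)].
    by right; right; rewrite dist2_self.
  by left; right; rewrite dist2_self dist2C.
- by exists p; split=> //; right; split=> //=; rewrite dist2_self dist2C.
- by exists q; split=> //; right; split=> //=; rewrite dist2_self.
- rewrite /A /B /=; case=> [xp|[xq xc]] [qx|[px xf]].
  + have xp' : 0 < rise x p by rewrite riseC oppr_gt0.
    have := curve_lt_trans lam lam0 E cE vE q x p Eq Ex Ep qx xp'; lra.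
  + by have := lt_trans xp px; rewrite ltxx.
  + by have := lt_trans qx xq; rewrite ltxx.
  + by have := lt_trans xc xf; rewrite ltxx.
Qed.

(** A sequence of arcs of E, each of which is one of the two halves of the
    previous one. *)
Definition bisected (E : set (heis R)) J (u v : nat -> heis R) :=
  (forall l, (l <= J)%N -> [/\ E (u l), E (v l) & 0 < rise (u l) (v l)]) /\
  (forall l, (l < J)%N -> exists2 m, is_midpoint E (u l) (v l) m &
     (u l.+1 = u l /\ v l.+1 = m) \/ (u l.+1 = m /\ v l.+1 = v l)).

Definition halving_depth (E : set (heis R)) J := forall u v : nat -> heis R,
  bisected E J u v -> dist2 (u J) (v J) <= 2^-1 * dist2 (u 0%N) (v 0%N).

(** Suppose that the last arc is longer than half of the first one.  By bounded
    turning all arcs, hence all their discarded siblings, have length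
    comparable to the first.  The end x l of the l-th sibling which is far from
    the retained half is at a comparable distance from all later points x l',
    which contradicts [heis_doubling] when J is large. *)
Lemma curve_halving : exists2 J : nat, (0 < J)%N &
  forall E : set (heis R), connected E -> vertical_curve lam E ->
  halving_depth E J.
Proof.
have K1 := turning_ge1 lam lam0.
set K := turning lam in K1 *.
have K0 : 0 < K by lra.
have [|J HJ] := @heis_doubling R (2 * K ^+ 3)^-1.
  by rewrite invr_gt0 mulr_gt0 // exprn_gt0.
have J0 : (0 < J)%N.
  have [||l [l' [ll' _]]] := HJ (heis_one R) (fun=> heis_one R) 1.
  - by [].
  - by move=> *; rewrite dist2_self.
  - by move: ll'; case: (J) => //; rewrite ltn0 andbF.
exists J => // E cE vE u v [uv half].
have nest := curve_nested lam lam0 E cE vE.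
have le_tr := curve_le_trans lam lam0 E cE vE.
have step l : (l < J)%N -> 0 <= rise (u l) (u l.+1) /\ 0 <= rise (v l.+1) (v l).
  move=> lJ; have [m [Em um mv _]] := half l lJ.
  by case=> [[-> ->]|[-> ->]]; rewrite rise_self; split=> //; exact: ltW.
have mono l d : (l + d <= J)%N -> 0 <= rise (u l) (u (l + d)%N) /\ 0 <=
  rise (v (l + d)%N) (v l).
  elim: d => [|d IH] ld; first by rewrite addn0 !rise_self.
  have ld' : (l + d < J)%N by rewrite addnS in ld.
  have [h1 h2] := IH (ltnW ld'); have [h3 h4] := step _ ld'.
  have [E1 E2 _] := uv l (leq_trans (leq_addr d l) (ltnW ld')).
  have [E3 E4 _] := uv _ (ltnW ld'); have [E5 E6 _] := uv _ ld'.
  by rewrite addnS; split; [apply: le_tr h1 h3|apply: le_tr h4 h2].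
(* x is the end of the discarded half that the retained half does not share. *)
have sib l : exists x, (l < J)%N -> [/\ E x, 0 <= rise (u l) x, 0 <=
  rise x (v l) &
    forall y, E y -> 0 <= rise (u l.+1) y -> 0 <= rise y (v l.+1) ->
    dist2 (u l.+1) (v l.+1) <= K * dist2 x y].
  case: (ltnP l J) => [lJ|_]; last by exists (u l).
  have [E1 E2 h] := uv l (ltnW lJ).
  have [m [Em um mv e] [[-> ->]|[-> ->]]] := half l lJ.
    exists (v l) => _; split; rewrite ?rise_self ?(ltW h)// => y Ey uy ym.
    by rewrite e dist2C [dist2 (v l) y]dist2C (dist2C m); apply: nest;
      rewrite ?rise_self ?(ltW mv).
  exists (u l) => _; split; rewrite ?rise_self ?(ltW h)// => y Ey my yv.
  by rewrite -e; apply: nest; rewrite ?rise_self ?(ltW um).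
have [x xP] := choice sib.
rewrite leNgt; apply/negP => big.
set D := dist2 (u 0%N) (v 0%N) in big *.
have [E0 E0' _] := uv 0%N isT.
have [EJ EJ' uvJ] := uv J (leqnn J).
have D0 : 0 < D by have [_ _ h] := uv 0%N isT; rewrite dist2_gt0// gt_eqF.
have [||l [l' [/andP[ll' l'J] hd]]] := HJ (u 0%N) x (K * D).
- by rewrite mulr_gt0.
- move=> l lJ; have [Ex ux xv _] := xP l lJ.
  have [El El' _] := uv l (ltnW lJ).
  have := mono 0%N l; rewrite add0n => /(_ (ltnW lJ))[h1 h2].
  by apply: nest; rewrite ?rise_self//; [apply: le_tr h1 ux|apply: le_tr xv h2].
have [Ex ux xv xfar] := xP l (ltn_trans ll' l'J).
have [Ex' ux' xv' _] := xP l' l'J.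
have [El El' _] := uv l' (ltnW l'J).
have [Ek Ek' _] := uv l.+1 (leq_trans ll' (ltnW l'J)).
have := mono l.+1 (l' - l.+1)%N; rewrite subnKC// => /(_ (ltnW l'J))[h1 h2].
have far : dist2 (u l.+1) (v l.+1) <= K * dist2 (x l) (x l').
  by apply: xfar => //; [apply: le_tr h1 ux'|apply: le_tr xv' h2].
have := mono l.+1 (J - l.+1)%N;
  rewrite subnKC ?(leq_trans ll' (ltnW l'J))// => /(_ (leqnn J))[h3 h4].
have far' : dist2 (u J) (v J) <= K * dist2 (u l.+1) (v l.+1).
  by apply: nest => //; exact: ltW.
have : dist2 (u J) (v J) <= 2^-1 * D; last by move: big; lra.
apply: le_trans far' _; apply: (@le_trans _ _ (K * (K * dist2 (x l) (x l')))).
  by rewrite ler_pM2l.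
apply: (@le_trans _ _ (K * (K * ((2 * K ^+ 3)^-1 * (K * D))))).
  by rewrite !ler_pM2l.
by rewrite le_eqVlt; apply/orP; left; apply/eqP; field; rewrite gt_eqF.
Qed.

End Midpoints.

(** * The dyadic parameter of a compact curve *)

Section Dyadic.
Context {R : realType} (lam : R).
Hypothesis lam0 : 0 < lam.
Variable E : set (heis R).
Hypothesis cE : connected E.
Hypothesis vE : vertical_curve lam E.
Variables a b : heis R.
Hypothesis Ea : E a.
Hypothesis Eb : E b.
Hypothesis ab : 0 < rise a b.
Hypothesis aE : forall r, E r -> 0 <= rise a r.
Hypothesis bE : forall r, E r -> 0 <= rise r b.
Implicit Types p q r m : heis R.

Let K := turning lam.
Let D0 := dist2 a b.
Let K1 : 1 <= K := turning_ge1 lam lam0.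
Let le_tr := curve_le_trans lam lam0 E cE vE.
Let lt_tr := curve_lt_trans lam lam0 E cE vE.
Let nest := curve_nested lam lam0 E cE vE.

Definition mid p q := xget p (is_midpoint E p q).

Lemma midP p q : E p -> E q -> 0 < rise p q -> is_midpoint E p q (mid p q).
Proof.
move=> Ep Eq pq; rewrite /mid; case: xgetP => [//|no].
by have [m /no] := curve_midpoint lam lam0 E p q cE vE Ep Eq pq.
Qed.

(** The 2^k + 1 points, in increasing order, obtained after k bisections of all
    arcs. *)
Fixpoint grid (k i : nat) : heis R :=
  match k with
  | 0 => if i is 0 then a else b
  | k'.+1 => if odd i then mid (grid k' i./2) (grid k' i./2.+1) else grid k'
    i./2
  end.

Lemma gridS_even k i : grid k.+1 i.*2 = grid k i.
Proof. by rewrite /= odd_double doubleK. Qed.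

Lemma gridS_odd k i : grid k.+1 i.*2.+1 = mid (grid k i) (grid k i.+1).
Proof. by rewrite /= odd_double/= uphalf_double. Qed.

Lemma grid_cell k : (forall i, (i <= 2 ^ k)%N -> E (grid k i)) /\
  (forall i, (i < 2 ^ k)%N -> 0 < rise (grid k i) (grid k i.+1)).
Proof.
elim: k => [|k [IH1 IH2]].
  by split=> [[|i]//|[|i]//].
have midg i : (i < 2 ^ k)%N ->
  is_midpoint E (grid k i) (grid k i.+1) (grid k.+1 i.*2.+1).
  by move=> ik; rewrite gridS_odd; apply: midP; [apply: IH1;
    exact: ltnW|exact: IH1|exact: IH2].
split=> i; rewrite -(odd_double_half i) expnS mul2n; case: (odd i);
  rewrite ?add1n ?add0n.
- rewrite ltn_double => h; by have [] := midg _ h.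
- by rewrite leq_double gridS_even; exact: IH1.
- rewrite -doubleS => h.
  have h' : (i./2 < 2 ^ k)%N by move: h; rewrite -ltn_double; exact: ltnW.
  by have [_ _ + _] := midg _ h'; rewrite gridS_even.
- rewrite ltn_double => h; have [_ + _ _] := midg _ h; by rewrite gridS_even.
Qed.

Lemma grid_in k i : (i <= 2 ^ k)%N -> E (grid k i).
Proof. exact: (grid_cell k).1. Qed.

Lemma grid_step k i : (i < 2 ^ k)%N -> 0 < rise (grid k i) (grid k i.+1).
Proof. exact: (grid_cell k).2. Qed.

Lemma grid_lt k i j : (i < j <= 2 ^ k)%N -> 0 < rise (grid k i) (grid k j).
Proof.
move=> /andP[]; elim: j => // j IH; rewrite ltnS leq_eqVlt =>
  /orP[/eqP ->|ij] jk.
  exact: grid_step.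
have jk' := ltnW jk; have ik : (i <= 2 ^ k)%N := leq_trans (ltnW ij) jk'.
by apply: (lt_tr _ (grid k j));
  [exact: grid_in|exact: grid_in|exact: grid_in|exact: IH|exact: grid_step].
Qed.

Lemma grid_le k i j : (i <= j <= 2 ^ k)%N -> 0 <= rise (grid k i) (grid k j).
Proof.
move=> /andP[]; rewrite leq_eqVlt => /orP[/eqP ->|ij] jk; first
  by rewrite rise_self.
by apply: ltW; apply: grid_lt; rewrite ij.
Qed.

Lemma grid_refine k l i : grid (k + l) (i * 2 ^ l) = grid k i.
Proof.
elim: l i => [|l IH] i; first by rewrite addn0 expn0 muln1.
by rewrite addnS expnS mulnCA mul2n gridS_even IH.
Qed.

Lemma grid_compare k i l j : (i <= 2 ^ k)%N -> (j <= 2 ^ l)%N ->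
  0 <= rise (grid l j) (grid k i) -> (j * 2 ^ k <= i * 2 ^ l)%N.
Proof.
move=> ik jl h; rewrite leqNgt; apply/negP => lt.
have := @grid_lt (k + l) (i * 2 ^ l) (j * 2 ^ k).
rewrite lt expnD [X in (_ <= X)%N]mulnC leq_mul2r jl orbT => /(_ isT).
by rewrite grid_refine addnC grid_refine riseC oppr_gt0 ltNge h.
Qed.

Lemma grid_locate k r : E r -> exists i, [/\ (i < 2 ^ k)%N,
  0 <= rise (grid k i) r & 0 <= rise r (grid k i.+1)].
Proof.
move=> Er; elim: k => [|k [i [ik ir ri]]].
  by exists 0%N; split=> //; [exact: aE|exact: bE].
have [mr|rm] := leP 0 (rise (grid k.+1 i.*2.+1) r).
  exists i.*2.+1; split=> //; last by rewrite -doubleS gridS_even.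
  by rewrite expnS mul2n -doubleS leq_double.
exists i.*2; split; first by rewrite expnS mul2n ltn_double.
  by rewrite gridS_even.
by rewrite riseC oppr_ge0 ltW.
Qed.

(** One factor theta for each bisection, by [dist2_le_mid]. *)
Lemma cell_lower k i : (i < 2 ^ k)%N ->
  D0 <= theta lam ^+ k * dist2 (grid k i) (grid k i.+1).
Proof.
have th0 : 0 < theta lam by have := theta_gt2 lam; lra.
elim: k i => [|k IH] i; first by case: i => // _; rewrite expr0 mul1r.
move=> ik.
have hk : (i./2 < 2 ^ k)%N.
  rewrite -ltn_double -[(2 ^ k).*2]mul2n -expnS; apply: leq_trans ik.
  by rewrite ltnS -{2}(odd_double_half i) leq_addl.
apply: le_trans (IH _ hk) _; rewrite exprSr -mulrA ler_pM2l ?exprn_gt0//.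
have [Em um mv e] :=
  midP _ _ (grid_in k i./2 (ltnW hk)) (grid_in k i./2.+1 hk) (grid_step k _ hk).
have E1 := grid_in k i./2 (ltnW hk); have E2 := grid_in k i./2.+1 hk.
have h : dist2 (grid k i./2) (grid k i./2.+1) <=
  theta lam * dist2 (grid k i./2) (mid (grid k i./2) (grid k i./2.+1)).
  by apply: dist2_le_mid => //; apply: (curve_cone lam E vE).
rewrite /= uphalf_half; case: (odd i); rewrite ?add0n ?add1n /=; last exact: h.
by rewrite -e.
Qed.

Section CellUpper.
Variable J : nat.
Hypothesis J0 : (0 < J)%N.
Hypothesis HJ : halving_depth E J.

(** The successive ancestors of a cell form a bisected sequence of arcs. *)
Lemma cell_halving k i : (i < 2 ^ (k + J))%N ->
  dist2 (grid (k + J) i) (grid (k + J) i.+1) <=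
  2^-1 * dist2 (grid k (i %/ 2 ^ J)) (grid k (i %/ 2 ^ J).+1).
Proof.
move=> iJ.
have := HJ (fun l => grid (k + l) (i %/ 2 ^ (J - l))) (fun l =>
  grid (k + l) (i %/ 2 ^ (J - l)).+1).
rewrite /= subnn expn0 divn1 addn0 subn0; apply; split=> [l lJ|].
  have h : (i %/ 2 ^ (J - l) < 2 ^ (k + l))%N.
    by rewrite ltn_divLR ?expn_gt0// -expnD -addnA subnKC.
  by split; [apply: grid_in; exact: ltnW|exact: grid_in|exact: grid_step].
move=> l lJ; rewrite -(subnSK lJ) expnSr divnMA divn2 addnS.
set n := (i %/ 2 ^ (J - l.+1))%N.
have h : (n < 2 ^ (k + l).+1)%N.
  by rewrite ltn_divLR ?expn_gt0// -addnS -expnD -addnA subnKC.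
have h2 : (n./2 < 2 ^ (k + l))%N.
  rewrite -ltn_double -[(2 ^ (k + l)).*2]mul2n -expnS; apply: leq_trans h.
  by rewrite ltnS -{2}(odd_double_half n) leq_addl.
exists (mid (grid (k + l) n./2) (grid (k + l) n./2.+1)).
  by apply: midP; [apply: grid_in; exact: ltnW|exact: grid_in|exact: grid_step].
by rewrite /= uphalf_half; case: (odd n); rewrite ?add0n ?add1n; [right|left].
Qed.

Lemma cell_upper_mul (m i : nat) : (i < 2 ^ (m * J))%N ->
  dist2 (grid (m * J) i) (grid (m * J) i.+1) <= 2^-1 ^+ m * D0.
Proof.
elim: m i => [|m IH] i.
  by rewrite mul0n expn0 expr0 mul1r; case: i.
rewrite mulSn addnC => h; apply: le_trans (cell_halving _ _ h) _.
rewrite exprS -mulrA ler_pM2l//; apply: IH.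
by rewrite ltn_divLR ?expn_gt0// -expnD.
Qed.

(** Halving at every J-th level; bounded turning covers the levels between. *)
Lemma cell_upper k i : (i < 2 ^ k)%N ->
  dist2 (grid k i) (grid k i.+1) <= K * (2^-1 ^+ (k %/ J) * D0).
Proof.
move: (divn_eq k J); move: (k %/ J)%N (k %% J)%N => m l -> h.
have h' : (i %/ 2 ^ l < 2 ^ (m * J))%N by rewrite ltn_divLR ?expn_gt0// -expnD.
have K0 : 0 < K := lt_le_trans ltr01 K1.
apply: (@le_trans _ _ (K * dist2 (grid (m * J) (i %/ 2 ^ l)) (grid (m * J) (i
  %/ 2 ^ l).+1))).
  have e1 : (i %/ 2 ^ l * 2 ^ l <= i)%N by exact: leq_trunc_div.
  have e2 : (i < (i %/ 2 ^ l).+1 * 2 ^ l)%N by exact: ltn_ceil (expn_gt0 2 l).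
  have e3 : ((i %/ 2 ^ l).+1 * 2 ^ l <= 2 ^ (m * J + l))%N
    by rewrite expnD leq_mul2r h' orbT.
  rewrite -(grid_refine (m * J) l (i %/ 2 ^ l)) -(grid_refine (m * J) l (i %/
    2 ^ l).+1).
  apply: nest.
  - by apply: grid_in; exact: leq_trans e1 (ltnW h).
  - by apply: grid_in; exact: ltnW.
  - exact: grid_in.
  - exact: grid_in.
  - by apply: grid_le; rewrite e1 ltnW.
  - by apply: ltW; exact: grid_step.
  - by apply: grid_le; rewrite e2 e3.
by rewrite ler_pM2l//; exact: cell_upper_mul.
Qed.

(** The parameter of r is the supremum of the parameters of the grid points that
    do not follow r. *)
Definition dyadic_set r : set R := [set x | exists k i,
  [/\ (i <= 2 ^ k)%N, 0 <= rise (grid k i) r & x = i%:R / 2 ^+ k]].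
Definition dyadic_param r : R := sup (dyadic_set r).

Lemma dyadic_set_ub r k i x : E r -> (i <= 2 ^ k)%N -> 0 <= rise r (grid k i) ->
  dyadic_set r x -> x <= i%:R / 2 ^+ k.
Proof.
move=> Er ik ri [l [j [jl jr ->]]].
have h : (j * 2 ^ k <= i * 2 ^ l)%N.
  by apply: grid_compare => //; apply: (le_tr _ r) => //; exact: grid_in.
rewrite ler_pdivrMr ?exprn_gt0// mulrAC ler_pdivlMr ?exprn_gt0//.
by rewrite -!natrX -!natrM ler_nat.
Qed.

Lemma dyadic_param_le r k i : E r -> (i <= 2 ^ k)%N -> 0 <= rise r (grid k i) ->
  dyadic_param r <= i%:R / 2 ^+ k.
Proof.
move=> Er ik ri; apply: ge_sup; last by move=> x; exact: dyadic_set_ub.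
by exists 0; exists 0%N, 0%N; rewrite mul0r; split=> //; exact: aE.
Qed.

Lemma dyadic_param_ge r k i : E r -> (i <= 2 ^ k)%N -> 0 <= rise (grid k i) r ->
  i%:R / 2 ^+ k <= dyadic_param r.
Proof.
move=> Er ik ri; apply: ub_le_sup; last by exists k, i.
exists (1%:R / 2 ^+ 0) => x; apply: (@dyadic_set_ub r 0 1) => //; exact: bE.
Qed.

Lemma dyadic_param_a : dyadic_param a = 0.
Proof.
apply/eqP; rewrite eq_le; apply/andP; split.
  by have := @dyadic_param_le a 0 0 Ea isT; rewrite mul0r; apply;
    rewrite rise_self.
by have := @dyadic_param_ge a 0 0 Ea isT; rewrite mul0r; apply;
  rewrite rise_self.
Qed.

Lemma dyadic_param_b : dyadic_param b = 1.
Proof.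
apply/eqP; rewrite eq_le; apply/andP; split.
  by have := @dyadic_param_le b 0 1 Eb isT; rewrite divr1; apply;
    rewrite rise_self.
by have := @dyadic_param_ge b 0 1 Eb isT; rewrite divr1; apply;
  rewrite rise_self.
Qed.

(** The triangle inequality through the common grid point costs a factor 2 for
    each of the two cells. *)
Lemma adjacent_cells_le k i j r r' (w : R) : E r -> E r' -> 0 < rise r r' ->
  (i < 2 ^ k)%N -> 0 <= rise (grid k i) r -> 0 <= rise r (grid k i.+1) ->
  (j < 2 ^ k)%N -> 0 <= rise (grid k j) r' -> 0 <= rise r' (grid k j.+1) ->
  (forall l, (l < 2 ^ k)%N -> dist2 (grid k l) (grid k l.+1) <= w) ->
  (j <= i.+1)%N -> dist2 r r' <= 4 * K * w.
Proof.
move=> Er Er' rr ik ir ri jk jr rj hw ji.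
have K0 : 0 < K := lt_le_trans ltr01 K1.
have w0 : 0 <= w := le_trans (dist2_ge0 _ _) (hw i ik).
have Kw0 : 0 <= K * w by rewrite mulr_ge0// ltW.
have Ei := grid_in k i (ltnW ik); have Ei1 := grid_in k i.+1 ik.
have Ej := grid_in k j (ltnW jk); have Ej1 := grid_in k j.+1 jk.
have cell l : (l < 2 ^ k)%N -> K * dist2 (grid k l) (grid k l.+1) <= K * w.
  by move=> lk; rewrite ler_pM2l// hw.
case: (ltngtP j i.+1) ji => // [ji|ji] _.
  move: ji; rewrite ltnS leq_eqVlt => /orP[/eqP ji|ji].
    suff : dist2 r r' <= K * w by rewrite -mulrA; lra.
    apply: le_trans (cell i ik); subst j; apply: nest => //; exact: ltW.
  exfalso; have h1 : 0 <= rise (grid k j.+1) (grid k i)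
    by rewrite grid_le// ji ltnW.
  have h2 := le_tr _ _ _ Ej1 Ei Er h1 ir.
  have h3 := le_tr _ _ _ Er' Ej1 Er rj h2.
  by move: rr; rewrite riseC oppr_gt0 ltNge h3.
subst j; apply: le_trans (dist2_tri2 r (grid k i.+1) r') _.
have h1 : dist2 r (grid k i.+1) <= K * w.
  by apply: le_trans (cell i ik); apply: nest => //; rewrite rise_self.
have h2 : dist2 (grid k i.+1) r' <= K * w.
  by apply: le_trans (cell i.+1 jk); apply: nest => //; rewrite rise_self.
by rewrite -mulrA; lra.
Qed.

(** A whole cell lies between r and r'. *)
Lemma separated_cells_ge k i j r r' : E r -> E r' ->
  (i < 2 ^ k)%N -> 0 <= rise r (grid k i.+1) ->
  (j < 2 ^ k)%N -> 0 <= rise (grid k j) r' ->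
  (i.+1 < j)%N -> D0 <= theta lam ^+ k * (K * dist2 r r').
Proof.
move=> Er Er' ik ri jk jr ij.
have th0 : 0 < theta lam by have := theta_gt2 lam; lra.
have i1k : (i.+1 < 2 ^ k)%N := ltn_trans ij jk.
apply: le_trans (cell_lower k i.+1 i1k) _; rewrite ler_pM2l ?exprn_gt0//.
have Ei := grid_in k i.+1 ik; have Ei1 := grid_in k i.+2 i1k.
have Ej := grid_in k j (ltnW jk).
apply: nest => //; first exact: ltW (grid_step k i.+1 i1k).
apply: (le_tr _ (grid k j)) => //; apply: grid_le; by rewrite ij ltnW.
Qed.

(** Parameters at distance less than 2^-k belong to equal or adjacent cells.  At
    level 0 there is only one cell, which covers a parameter difference of 1. *)
Lemma dist2_upper k r r' : E r -> E r' -> 0 < rise r r' ->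
  (k = 0%N \/ dyadic_param r' - dyadic_param r < 2^-1 ^+ k) ->
  dist2 r r' <= 4 * K * (K * (2^-1 ^+ (k %/ J) * D0)).
Proof.
move=> Er Er' rr hk.
have [i [ik ir ri]] := grid_locate k r Er.
have [j [jk jr rj]] := grid_locate k r' Er'.
apply: (adjacent_cells_le k i j) => //; first exact: cell_upper.
case: hk => [k0|]; first by move: jk; rewrite k0; case: (j).
move=> h; rewrite leqNgt; apply/negP => ij.
have t := dyadic_param_le r k i.+1 Er ik ri.
have t' := dyadic_param_ge r' k j Er' (ltnW jk) jr.
have : (i.+2%:R : R) <= j%:R by rewrite ler_nat.
rewrite -natr1 => hij.
have p0 : (0 : R) < 2^-1 ^+ k by rewrite exprn_gt0.
move: t t'; rewrite -!exprVn => t t'.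
have : (i.+1%:R + 1) * 2^-1 ^+ k <= j%:R * 2^-1 ^+ k :> R by rewrite ler_pM2r.
lra.
Qed.

(** Parameters at distance more than 2 * 2^-k have a whole cell between them. *)
Lemma dist2_lower k r r' : E r -> E r' ->
  2 * 2^-1 ^+ k < dyadic_param r' - dyadic_param r ->
  D0 <= theta lam ^+ k * (K * dist2 r r').
Proof.
move=> Er Er' h.
have [i [ik ir ri]] := grid_locate k r Er.
have [j [jk jr rj]] := grid_locate k r' Er'.
apply: (separated_cells_ge k i j) => //.
have t := dyadic_param_ge r k i Er (ltnW ik) ir.
have t' := dyadic_param_le r' k j.+1 Er' jk rj.
rewrite ltnNge; apply/negP => ji.
have : (j.+1%:R : R) <= i.+2%:R by rewrite ler_nat.
rewrite -[i.+2%:R]natr1 -[i.+1%:R]natr1 => hij.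
have p0 : (0 : R) < 2^-1 ^+ k by rewrite exprn_gt0.
move: t t'; rewrite -!exprVn => t t'.
have : j.+1%:R * 2^-1 ^+ k <= (i%:R + 1 + 1) * 2^-1 ^+ k :> R
  by rewrite ler_pM2r.
lra.
Qed.

Lemma D0_gt0 : 0 < D0.
Proof. by rewrite dist2_gt0// gt_eqF. Qed.

Lemma half_expr_small (e : R) : 0 < e -> exists n : nat, 2^-1 ^+ n < e.
Proof.
move=> e0; have [n hn] : exists n : nat, e^-1 < n%:R.
  have e0' : 0 <= e^-1 by rewrite invr_ge0 ltW.
  by exists (Num.truncn e^-1).+1; have /andP[] := truncn_itv e0'.
exists n; rewrite exprVn -[X in _ < X]invrK ltf_pV2 ?posrE ?invr_gt0
  ?exprn_gt0//.
by apply: lt_trans hn _; rewrite -natrX ltr_nat ltn_expl.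
Qed.

Lemma dyadic_param_inc r r' : E r -> E r' -> 0 < rise r r' ->
  dyadic_param r < dyadic_param r'.
Proof.
move=> Er Er' rr; rewrite ltNge; apply/negP => h.
have K0 : 0 < K := lt_le_trans ltr01 K1.
have d0 : 0 < dist2 r r' by rewrite dist2_gt0// gt_eqF.
pose c := 4 * K * (K * D0).
have four : (0 : R) < 4 by [].
have c0 : 0 < c := mulr_gt0 (mulr_gt0 four K0) (mulr_gt0 K0 D0_gt0).
have [n hn] := half_expr_small (dist2 r r' / c) (divr_gt0 d0 c0).
have := dist2_upper (n * J) r r' Er Er' rr; rewrite mulnK// => H.
have : dist2 r r' <= 4 * K * (K * (2^-1 ^+ n * D0)).
  by apply: H; right; apply: (@le_lt_trans _ _ 0);
    rewrite ?exprn_gt0// subr_le0.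
apply/negP; rewrite -ltNge.
rewrite (_ : 4 * K * _ = 2^-1 ^+ n * c); last by rewrite /c; ring.
by rewrite -ltr_pdivlMr.
Qed.

Lemma dyadic_param_itv r : E r -> 0 <= dyadic_param r <= 1.
Proof.
move=> Er; apply/andP; split.
  by have := @dyadic_param_ge r 0 0 Er isT; rewrite mul0r; apply; exact: aE.
by have := @dyadic_param_le r 0 1 Er isT; rewrite divr1; apply; exact: bE.
Qed.

End CellUpper.

End Dyadic.

(** * Hoelder exponents *)

Section Exponents.
Context {R : realType}.

(** For 1 <= d no scale satisfies d < 2^-k, hence the alternative k = 0. *)
Lemma dyadic_scale (d : R) : 0 < d -> exists k : nat,
  2^-1 ^+ k.+1 <= d /\ (k = 0%N \/ d < 2^-1 ^+ k).
Proof.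
move=> d0.
have ex : exists k, (2^-1 ^+ k.+1 <= d :> R).
  have [n hn] := half_expr_small d d0; exists n; apply: le_trans (ltW hn).
  by rewrite exprS ler_piMl ?exprn_ge0// invf_le1// ler1n.
case: (ex_minnP ex) => k hk kmin; exists k; split=> //.
case: k hk kmin => [|k] hk kmin; [by left|right].
by rewrite ltNge; apply/negP => /kmin; rewrite ltnn.
Qed.

(** The exponent log2 th turns the dyadic scale 2^-k into the scale th^-k of
    [cell_lower]. *)
Lemma powR_half_log (th : R) (k : nat) : 0 < th ->
  (2^-1 ^+ k) `^ (ln th / ln 2) = th ^- k.
Proof.
move=> th0.
have l2 : 0 < ln (2 : R) by rewrite ln_gt0// ltr1n.
have h2 : (2^-1 : R) \is Num.pos by rewrite posrE.
rewrite -(powR_mulrn k (_ : 0 <=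
  2^-1))// -powRrM [X in _ `^ X]mulrC powRrM powR_mulrn ?powR_ge0//.
rewrite -exprVn; congr (_ ^+ _).
rewrite /powR gt_eqF ?invr_gt0// lnV ?posrE// mulrN mulfVK ?gt_eqF//.
by rewrite expRN lnK.
Qed.

Lemma sqr_powR (x r : R) : (x `^ (r / 2)) ^+ 2 = x `^ r.
Proof. by rewrite -powR_mulrn ?powR_ge0// -powRrM divfK. Qed.
End Exponents.

Section Holder.
Context {R : realType} (lam : R).
Hypothesis lam0 : 0 < lam.
Variable E : set (heis R).
Hypothesis cE : connected E.
Hypothesis vE : vertical_curve lam E.
Variables a b : heis R.
Hypothesis Ea : E a.
Hypothesis Eb : E b.
Hypothesis ab : 0 < rise a b.
Hypothesis aE : forall r, E r -> 0 <= rise a r.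
Hypothesis bE : forall r, E r -> 0 <= rise r b.
Variable J : nat.
Hypothesis J0 : (0 < J)%N.
Hypothesis HJ : halving_depth E J.

Let K := turning lam.
Let D0 := dist2 a b.
Let tau := dyadic_param E a b.
Let th := theta lam.
Let K0 : 0 < K := lt_le_trans ltr01 (turning_ge1 lam lam0).
Let D00 : 0 < D0 := D0_gt0 a b ab.
Let th0 : 0 < th := lt_trans (ltr0Sn R 1) (theta_gt2 lam).
Let upper := dist2_upper lam lam0 E cE vE a b Ea Eb ab aE bE J HJ.
Let lower := dist2_lower lam lam0 E cE vE a b Ea Eb ab aE bE.
Let inc := dyadic_param_inc lam lam0 E cE vE a b Ea Eb ab aE bE J J0 HJ.
Let itv := dyadic_param_itv lam lam0 E cE vE a b Ea Eb ab aE bE.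

Lemma dyadic_param_continuous : {within E, continuous tau}.
Proof.
apply: within_continuous_dist2 => p e Ep e0.
have e20 : 0 < e / 2 by rewrite divr_gt0.
have [k hk] := half_expr_small (e / 2) e20.
have thk : 0 < th ^+ k by rewrite exprn_gt0.
have thK : 0 < th ^+ k * K := mulr_gt0 thk K0.
exists (D0 / (th ^+ k * K)); first exact: divr_gt0.
move=> r Er; rewrite ltr_pdivlMr// => h.
have h' : th ^+ k * (K * dist2 p r) < D0 by rewrite mulrA mulrC.
have hk' : 2 * 2^-1 ^+ k < e by move: hk; rewrite ltr_pdivlMr// mulrC.
rewrite ltNge; apply/negP; rewrite ler_normr => /orP[|] ge.
  have : D0 <= th ^+ k * (K * dist2 r p) by apply: lower => //;
    exact: lt_le_trans hk' ge.
  by rewrite dist2C leNgt h'.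
have : D0 <= th ^+ k * (K * dist2 p r).
  by apply: lower => //; rewrite opprB in ge; exact: lt_le_trans hk' ge.
by rewrite leNgt h'.
Qed.

(** At the scale 2^-k of the parameter difference, [dist2_upper] gives about
    2^-(k / J). *)
Lemma dist2_le_holder r r' : E r -> E r' -> 0 < rise r r' ->
  dist2 r r' <= 8 * K ^+ 2 * D0 * (tau r' - tau r) `^ J%:R^-1.
Proof.
move=> Er Er' rr.
have d0 : 0 < tau r' - tau r by rewrite subr_gt0; exact: inc.
have [k [k1 k2]] := dyadic_scale _ d0.
apply: le_trans (upper k r r' Er Er' rr k2) _.
(* Passing from y to y / 2 compensates for the rounding in k %/ J. *)
set y := 2^-1 ^+ (k %/ J).
have y0 : 0 <= 2^-1 * y by rewrite mulr_ge0// exprn_ge0.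
suff h : 2^-1 * y <= (tau r' - tau r) `^ J%:R^-1.
  have KD : 0 < 8 * K ^+ 2 * D0
    by rewrite (mulr_gt0 _ D00)// mulr_gt0// exprn_gt0.
  rewrite (_ : 4 * _ * _ = 8 * K ^+ 2 * D0 * (2^-1 * y)); last
    by rewrite -/K -/D0; field.
  by rewrite ler_pM2l.
have J0' : (0 : R) < J%:R by rewrite ltr0n.
have Jn : (J%:R : R) != 0 by rewrite gt_eqF.
have -> : 2^-1 * y = ((2^-1 * y) ^+ J) `^ J%:R^-1.
  by rewrite -powR_mulrn// -powRrM mulfV// powRr1.
apply: ge0_ler_powR; rewrite ?nnegrE ?invr_ge0 ?exprn_ge0 ?(ltW d0)//.
apply: le_trans k1.
rewrite -exprS -exprM; apply: ler_wiXn2l => //.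
  by rewrite invf_le1// ler1n.
by rewrite {1}(divn_eq k J) mulSn addnC ltn_add2r ltn_mod.
Qed.

(** Three levels below the scale of the parameter difference, [dist2_lower]
    applies; this costs the factor theta^3. *)
Lemma dist2_ge_holder r r' : E r -> E r' -> 0 < rise r r' ->
  D0 * (tau r' - tau r) `^ (ln th / ln 2) <= th ^+ 3 * K * dist2 r r'.
Proof.
move=> Er Er' rr.
have d0 : 0 < tau r' - tau r by rewrite subr_gt0; exact: inc.
have [k [k1 k2]] := dyadic_scale _ d0.
have dk : tau r' - tau r <= 2^-1 ^+ k.
  case: k2 => [->|/ltW//]; rewrite expr0.
  by have /andP[_] := itv r' Er'; have /andP[] := itv r Er; rewrite -/tau; lra.
have low : D0 <= th ^+ k.+3 * (K * dist2 r r').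
  apply: lower => //; apply: lt_le_trans k1.
  have p0 : (0 : R) < 2^-1 ^+ k by rewrite exprn_gt0.
  by rewrite !exprS; move: p0; lra.
have l2 : 0 < ln (2 : R) by rewrite ln_gt0// ltr1n.
have lth : 0 <= ln th / ln 2.
  rewrite divr_ge0 ?(ltW l2)// ln_ge0//.
  by have := theta_gt2 lam; rewrite -/th; lra.
have thk : 0 < th ^+ k by rewrite exprn_gt0.
have pw : (tau r' - tau r) `^ (ln th / ln 2) <= (th ^+ k)^-1.
  rewrite -powR_half_log//.
  by apply: ge0_ler_powR; rewrite ?nnegrE ?exprn_ge0 ?(ltW d0)//.
apply: (@le_trans _ _ (th ^+ k.+3 * (K * dist2 r r') * (th ^+ k)^-1)).
  by apply: ler_pM => //; [exact: ltW|exact: powR_ge0].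
rewrite -addn3 exprD le_eqVlt; apply/orP; left; apply/eqP.
by field; rewrite gt_eqF.
Qed.

Lemma dyadic_param_bi_holder : exists2 C : R, 0 < C &
  forall r r', E r -> E r' -> 0 < rise r r' ->
  C^-1 * (tau r' - tau r) `^ (ln th / ln 2 / 2) < kor_dist r r' /\
  kor_dist r r' < C * (tau r' - tau r) `^ (J%:R^-1 / 2).
Proof.
pose c1 := 8 * K ^+ 2 * D0.
pose c2 := th ^+ 3 * K / D0.
have c10 : 0 < c1 by rewrite (mulr_gt0 _ D00)// mulr_gt0// exprn_gt0.
have c20 : 0 < c2 by rewrite divr_gt0// (mulr_gt0 _ K0)// exprn_gt0.
pose C := 1 + c1 + c2.
have C0 : 0 < C by rewrite !addr_gt0.
have C2 : C <= C ^+ 2 by rewrite expr2 ler_peMr ?ltW// /C; lra.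
exists C => // r r' Er Er' rr.
have d0 : 0 < tau r' - tau r by rewrite subr_gt0; exact: inc.
have dd : 0 < dist2 r r' by rewrite dist2_gt0// gt_eqF.
split.
- rewrite -(@ltr_pXn2r _ 2) ?nnegrE ?kor_dist_ge0 ?mulr_ge0 ?powR_ge0
  ?invr_ge0 ?(ltW C0)//.
  rewrite sqr_kor_dist exprMn sqr_powR exprVn mulrC ltr_pdivrMr ?exprn_gt0//.
  have := dist2_ge_holder r r' Er Er' rr.
  rewrite mulrC -ler_pdivlMr// [_ * dist2 _ _ / _]mulrAC -/c2 =>
    /le_lt_trans; apply.
  rewrite mulrC ltr_pM2l//; apply: lt_le_trans C2; rewrite /C; lra.
- have p0 : 0 < (tau r' - tau r) `^ J%:R^-1 by rewrite powR_gt0.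
  rewrite -(@ltr_pXn2r _ 2) ?nnegrE ?kor_dist_ge0 ?mulr_ge0 ?powR_ge0 ?(ltW
    C0)//.
  rewrite sqr_kor_dist exprMn sqr_powR.
  apply: le_lt_trans (dist2_le_holder r r' Er Er' rr) _.
  rewrite -/c1 ltr_pM2r//; apply: lt_le_trans C2; rewrite /C; lra.
Qed.

End Holder.

(** * Endpoints and conclusion *)

Section Main.
Context {R : realType} (lam : R).
Hypothesis lam0 : 0 < lam.

(** An increasing continuous function attains its bounds on a compact set. *)
Lemma curve_endpoints (E : set (heis R)) : connected E ->
  vertical_curve lam E ->
  compact E -> (exists p q, [/\ E p, E q & p <> q]) ->
  exists a b, [/\ E a, E b, 0 < rise a b, forall r, E r -> 0 <= rise a r &
    forall r, E r -> 0 <= rise r b].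
Proof.
move=> cE vE kE [p [q [Ep Eq pq]]].
have [tau [tc ti]] := curve_global_parameter lam lam0 E cE vE.
have E0 : E !=set0 by exists p.
have [b] := compact_EVT_max E0 kE tc; rewrite inE => Eb bmax.
have [a] := compact_EVT_min E0 kE tc; rewrite inE => Ea amin.
have aE r : E r -> 0 <= rise a r.
  move=> Er; rewrite leNgt; apply/negP => h.
  have := ti r a Er Ea; rewrite riseC oppr_gt0 => /(_ h); rewrite ltNge amin//.
  by rewrite inE.
have bE r : E r -> 0 <= rise r b.
  move=> Er; rewrite riseC oppr_ge0 leNgt; apply/negP => /(ti b r Eb Er).
  by rewrite ltNge bmax// inE.
exists a, b; split=> //; rewrite lt_neqAle aE// andbT eq_sym.
apply/eqP => /(curve_rise0 lam lam0 E vE a b Ea Eb) ab; apply: pq.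
have all_a r : E r -> r = a.
  move=> Er; apply: (curve_rise0 lam lam0 E vE) => //.
  by apply/eqP; rewrite eq_le {2}ab bE// andbT riseC oppr_le0 aE.
by rewrite (all_a p)// (all_a q).
Qed.

End Main.

Theorem proposition1p1 (R : realType) (lambda : R) (lambda_gt0 : 0 < lambda) :
  (forall E : set (heis R), connected E -> vertical_curve lambda E ->
     exists (I : set R) (gamma : R -> heis R),
       [/\ is_interval I, homeo_onto I E gamma &
           increasing_param lambda I gamma])
  /\
  (exists alpha beta : R,
     [/\ 0 < alpha, alpha < beta & beta < 1] /\
     forall E : set (heis R), connected E -> vertical_curve lambda E ->
       compact E -> (exists p q : heis R, [/\ E p, E q & p <> q]) ->
       exists gamma : R -> heis R,
         [/\ homeo_onto (`[0, 1] : set R) E gamma,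
             increasing_param lambda `[0, 1] gamma &
             exists2 C : R, 0 < C &
               forall s t : R, s \in `[0, 1] -> t \in `[0, 1] -> s != t ->
                 C^-1 * `|s - t| `^ beta < kor_dist (gamma s) (gamma t) /\
                 kor_dist (gamma s) (gamma t) < C * `|s - t| `^ alpha]).
Proof.
split.
  move=> E cE vE.
  have [tau [tc ti]] := curve_global_parameter lambda lambda_gt0 E cE vE.
  exists (tau @` E), (inv_param E tau).
  exact: curve_parametrization.
have [J J0 HJ] := curve_halving lambda lambda_gt0.
have l2 : 0 < ln (2 : R) by rewrite ln_gt0// ltr1n.
have th2 := theta_gt2 lambda.
have th4 := theta_lt4 lambda lambda_gt0.
have J0' : (0 : R) < J%:R by rewrite ltr0n.
have log_gt1 : 1 < ln (theta lambda) / ln 2.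
  by rewrite ltr_pdivlMr// mul1r ltr_ln ?posrE//; lra.
have log_lt2 : ln (theta lambda) / ln 2 < 2.
  rewrite ltr_pdivrMr// mulr_natl -lnXn// ltr_ln ?posrE ?exprn_gt0//; last
    by lra.
  by rewrite expr2; lra.
exists (J%:R^-1 / 2), (ln (theta lambda) / ln 2 / 2); split.
  split; first by rewrite divr_gt0 ?invr_gt0.
    rewrite ltr_pM2r ?invr_gt0//; apply: le_lt_trans log_gt1.
    by rewrite invf_le1// ler1n.
  by rewrite ltr_pdivrMr// mul1r.
move=> E cE vE kE ne.
have [a [b [Ea Eb ab aE bE]]] :=
  curve_endpoints lambda lambda_gt0 E cE vE kE ne.
have HE := HJ E cE vE.
pose tau := dyadic_param E a b.
have tc : {within E, continuous tau} by exact: (dyadic_param_continuous lambda).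
have ti p q : E p -> E q -> 0 < rise p q -> tau p < tau q.
  exact: (dyadic_param_inc lambda lambda_gt0 E cE vE a b Ea Eb ab aE bE J J0
    HE).
have [iI hI gI] := curve_parametrization lambda lambda_gt0 E cE vE tau tc ti.
have II : tau @` E = `[0, 1]%classic.
  apply/seteqP; split=> [_ [r Er <-]|t] /=.
    by rewrite in_itv/=; exact: (dyadic_param_itv lambda).
  rewrite in_itv/=; apply: iI; [exists a|exists b] => //.
    exact: (dyadic_param_a lambda).
  exact: (dyadic_param_b lambda).
have tauK t : t \in `[0, 1] -> E (inv_param E tau t) /\
  tau (inv_param E tau t) = t.
  by move=> t01; apply: inv_paramP; rewrite II.
rewrite II in hI gI.
exists (inv_param E tau); split=> //.
have [C C0 HC] :=
  dyadic_param_bi_holder lambda lambda_gt0 E cE vE a b Ea Eb ab aE bE J J0 HE.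
exists C => // s t s01 t01.
wlog st : s t s01 t01 / s < t.
  move=> wl; rewrite neq_lt => /orP[|] h; first by apply: wl => //;
    rewrite lt_eqF.
  by rewrite distrC kor_distC; apply: wl => //; rewrite lt_eqF.
move=> _; have [Es es] := tauK s s01; have [Et et] := tauK t t01.
rewrite distrC gtr0_norm ?subr_gt0//.
have := HC (inv_param E tau s) (inv_param E tau t) Es Et.
rewrite -/tau es et; apply.
by apply: (tau_lt lambda lambda_gt0 E vE tau ti) => //; rewrite es et.
Qed.
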